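(* Let $M$ be a smooth manifold. A $^*$-ideal $\mathcal I\subseteq C^\infty(M)$ is closed if and only if it is the vanishing ideal of some closed set $F\subseteq M$. Moreover, $\mathcal I=\ker\pi_\omega$ for some GNS representation $\pi_\omega$ if and only if $\mathcal I=\mathcal I_K$ for some compact set $K\subseteq M$.
   Context: $C^\infty(M)$ is the $^*$-algebra over $\mathbb C$ of complex-valued smooth functions on a finite-dimensional smooth manifold $M$ (not assumed compact), with complex conjugation as $^*$-involution. A $^*$-ideal is an ideal closed under the involution. For a closed set $F\subseteq M$ its vanishing ideal is $\mathcal I_F=\{f\in C^\infty(M): f|_F=0\}$. A complex pre-Hilbert space is a complex vector space $\mathfrak H$ with a positive-definite Hermitian product, linear in the second argument ($\mathfrak H=0$ allowed); $\mathfrak B(\mathfrak H)$ is the $^*$-algebra of all linear maps $\mathfrak H\to\mathfrak H$ having an adjoint on $\mathfrak H$. A $^*$-representation of a $^*$-algebra $\mathcal A$ is a $^*$-homomorphism $\pi:\mathcal A\to\mathfrak B(\mathfrak H)$. A $^*$-ideal is called closed if it is the kernel of some $^*$-representation on a complex pre-Hilbert space. A linear functional $\omega:\mathcal A\to\mathbb C$ is positive if $\omega(A^*A)\ge0$ for all $A$ (no continuity assumed). Its GNS representation $\pi_\omega$ acts on $\mathfrak H_\omega=\mathcal A/\mathcal J_\omega$, where $\mathcal J_\omega=\{A:\omega(A^*A)=0\}$, with inner product $\langle\psi_B,\psi_C\rangle=\omega(B^*C)$ and $\pi_\omega(A)\psi_B=\psi_{AB}$, where $\psi_B$ is the class of $B$.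 *)

(* Defs.v *)
From HB Require Import structures.
From mathcomp Require Import all_boot all_order all_algebra.
From mathcomp Require Import ring lra.
From mathcomp Require Import generic_quotient ring_quotient.
From mathcomp Require Import complex.
From mathcomp Require Import all_classical all_reals all_analysis.
Set Implicit Arguments.
Unset Strict Implicit.
Unset Printing Implicit Defensive.
Import Order.TTheory GRing.Theory Num.Theory numFieldNormedType.Exports.
Local Open Scope classical_set_scope.
Local Open Scope ring_scope.
Local Open Scope quotient_scope.

Reserved Notation "a ** b" (at level 40, left associativity).

(* Not based on [algType], which requires 1 != 0: the zero algebra must be    *)
(* allowed, since it arises as C^oo of the empty manifold and as B(H) for     *)
(* H = 0.                                                                     *)
HB.mixin Record isStarAlgebra (C : numClosedFieldType) A
    of GRing.Lmodule C A := {
  amul : A -> A -> A;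
  star : A -> A;
  amulA : associative amul;
  amulDl : left_distributive amul +%R;
  amulDr : right_distributive amul +%R;
  amulZl : forall (k : C) (a b : A), amul (k *: a) b = k *: amul a b;
  amulZr : forall (k : C) (a b : A), amul a (k *: b) = k *: amul a b;
  starD : forall a b : A, star (a + b) = star a + star b;
  starZ : forall (k : C) (a : A), star (k *: a) = k^* *: star a;
  starM : forall a b : A, star (amul a b) = amul (star b) (star a);
  starK : involutive star
}.

#[short(type="starAlgType")]
HB.structure Definition StarAlgebra (C : numClosedFieldType) :=
  {A of GRing.Lmodule C A & isStarAlgebra C A}.

Notation "a ** b" := (amul a b) : ring_scope.

Record starHom (C : numClosedFieldType) (A B : starAlgType C) := StarHom {
  starHom_fun :> A -> B;
  starHomD : forall a b, starHom_fun (a + b) = starHom_fun a + starHom_fun b;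
  starHomZ : forall (k : C) a, starHom_fun (k *: a) = k *: starHom_fun a;
  starHomM : forall a b, starHom_fun (a ** b) = starHom_fun a ** starHom_fun b;
  starHom_star : forall a, starHom_fun (star a) = star (starHom_fun a)
}.

Definition starHom_ker (C : numClosedFieldType) (A B : starAlgType C)
  (f : starHom A B) : set A := [set a | f a = 0].

Record star_ideal (C : numClosedFieldType) (A : starAlgType C) (I : set A) :
    Prop := StarIdeal {
  star_ideal0 : I 0;
  star_idealD : forall a b, I a -> I b -> I (a + b);
  star_idealZ : forall (k : C) a, I a -> I (k *: a);
  star_idealMl : forall a b, I b -> I (a ** b);
  star_idealMr : forall a b, I a -> I (a ** b);
  star_ideal_star : forall a, I a -> I (star a)
}.

HB.mixin Record isPreHilbert (C : numClosedFieldType) H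
    of GRing.Lmodule C H := {
  inner : H -> H -> C;
  innerDr : forall x y z : H, inner x (y + z) = inner x y + inner x z;
  innerZr : forall (k : C) (x y : H), inner x (k *: y) = k * inner x y;
  inner_conj : forall x y : H, inner y x = (inner x y)^*;
  inner_gt0 : forall x : H, x != 0 -> 0 < inner x x
}.

#[short(type="preHilbertType")]
HB.structure Definition PreHilbert (C : numClosedFieldType) :=
  {H of GRing.Lmodule C H & isPreHilbert C H}.

Section Inner.
Variables (C : numClosedFieldType) (H : preHilbertType C).
Implicit Types x y z : H.

Lemma innerDl x y z : inner (x + y) z = inner x z + inner y z.
Proof. by rewrite inner_conj innerDr rmorphD /= -!inner_conj. Qed.

Lemma innerZl (k : C) x y : inner (k *: x) y = k^* * inner x y.
Proof. by rewrite inner_conj innerZr rmorphM /= -inner_conj. Qed.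

Lemma inner0r x : inner x 0 = 0.
Proof. by rewrite -(scale0r 0) innerZr mul0r. Qed.

Lemma innerNr x y : inner x (- y) = - inner x y.
Proof. by rewrite -scaleN1r innerZr mulN1r. Qed.

Lemma inner_injr x y : (forall z, inner z x = inner z y) -> x = y.
Proof.
move=> xy; apply/eqP; rewrite -subr_eq0; apply/negPn/negP => /inner_gt0.
by rewrite innerDr innerNr xy subrr ltxx.
Qed.

Lemma inner_injl x y : (forall z, inner x z = inner y z) -> x = y.
Proof.
by move=> xy; apply: inner_injr => z; rewrite inner_conj xy -inner_conj.
Qed.
End Inner.

Definition is_adjoint (C : numClosedFieldType) (H : preHilbertType C)
  (S T : H -> H) := forall x y, inner (S x) y = inner x (T y).

Definition adjointable (C : numClosedFieldType) (H : preHilbertType C)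
    (T : H -> H) :=
  (forall (k : C) (x y : H), T (k *: x + y) = k *: T x + T y) /\
  exists S : H -> H, is_adjoint S T.

(* The *-algebra B(H).                                                        *)
Record adjOp (C : numClosedFieldType) (H : preHilbertType C) := AdjOp {
  adjOp_fun :> H -> H;
  adjOpP : `[< adjointable adjOp_fun >]
}.

Section AdjOp.
Variables (C : numClosedFieldType) (H : preHilbertType C).
Implicit Types S T U : adjOp H.

HB.instance Definition _ := [isSub for (@adjOp_fun C H)].
HB.instance Definition _ := [Choice of adjOp H by <:].

Lemma adjOp_eq S T : (forall x, S x = T x) -> S = T.
Proof. by move=> ST; apply: val_inj; apply/funext. Qed.

Lemma adjOp_lin T (k : C) x y : T (k *: x + y) = k *: T x + T y.
Proof. by case: T => T /= /asboolP[]. Qed.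

Lemma adjOpD T x y : T (x + y) = T x + T y.
Proof. by have := adjOp_lin T 1 x y; rewrite !scale1r. Qed.

Lemma adjOp0 T : T 0 = 0.
Proof. by have /eqP := adjOpD T 0 0; rewrite addr0 -subr_eq0 opprD addrA subrr sub0r oppr_eq0 => /eqP. Qed.

Lemma adjOpZ T (k : C) x : T (k *: x) = k *: T x.
Proof. by have := adjOp_lin T k x 0; rewrite adjOp0 !addr0. Qed.

Lemma adjOp_ex T : exists S : H -> H, is_adjoint S T.
Proof. by case: T => T /= /asboolP[]. Qed.

Definition adj_fun T : H -> H := sval (cid (adjOp_ex T)).

Lemma adj_funP T : is_adjoint (adj_fun T) T.
Proof. exact: svalP (cid (adjOp_ex T)). Qed.

Lemma adj_funPr T x y : inner x (adj_fun T y) = inner (T x) y.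
Proof. by rewrite inner_conj adj_funP -inner_conj. Qed.

Lemma adj_subproof T : `[< adjointable (adj_fun T) >].
Proof.
apply/asboolP; split; last first.
  by exists T => x y; rewrite adj_funPr.
move=> k x y; apply: inner_injl => z.
by rewrite adj_funP innerDl innerZl innerDl innerZl !adj_funP.
Qed.
Definition adj T := AdjOp (adj_subproof T).

Lemma adjP T : is_adjoint (adj T) T. Proof. exact: adj_funP. Qed.

Lemma adj_unique S T : is_adjoint S T -> adj T = S.
Proof.
by move=> ST; apply: adjOp_eq => x; apply: inner_injl => z; rewrite adjP ST.
Qed.

Lemma zero_subproof : `[< adjointable (fun _ : H => 0 : H) >].
Proof.
apply/asboolP; split=> [k x y|]; first by rewrite scaler0 addr0.
exists (fun=> 0) => x y.
by rewrite inner0r inner_conj inner0r rmorph0.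
Qed.
Definition adjOp_zero := AdjOp zero_subproof.

Lemma opp_subproof T : `[< adjointable (fun x => - T x) >].
Proof.
apply/asboolP; split=> [k x y|].
  by rewrite adjOp_lin opprD scalerN.
exists (fun x => - adj T x) => x y.
by rewrite innerNr -scaleN1r innerZl rmorphN rmorph1 mulN1r adjP.
Qed.
Definition adjOp_opp T := AdjOp (opp_subproof T).

Lemma add_subproof S T : `[< adjointable (fun x => S x + T x) >].
Proof.
apply/asboolP; split=> [k x y|].
  by rewrite !adjOp_lin scalerDr addrACA.
by exists (fun x => adj S x + adj T x) => x y; rewrite innerDl innerDr !adjP.
Qed.
Definition adjOp_add S T := AdjOp (add_subproof S T).

Lemma scale_subproof (k : C) T : `[< adjointable (fun x => k *: T x) >].
Proof.
apply/asboolP; split=> [l x y|].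
  by rewrite adjOp_lin scalerDr !scalerA mulrC.
exists (fun x => k^* *: adj T x) => x y.
by rewrite innerZl innerZr conjCK adjP.
Qed.
Definition adjOp_scale k T := AdjOp (scale_subproof k T).

Lemma mul_subproof S T : `[< adjointable (fun x => S (T x)) >].
Proof.
apply/asboolP; split=> [k x y|]; first by rewrite !adjOp_lin.
by exists (fun x => adj T (adj S x)) => x y; rewrite !adjP.
Qed.
Definition adjOp_mul S T := AdjOp (mul_subproof S T).

Fact adjOp_addA : associative adjOp_add.
Proof. by move=> S T U; apply: adjOp_eq => x /=; rewrite addrA. Qed.
Fact adjOp_addC : commutative adjOp_add.
Proof. by move=> S T; apply: adjOp_eq => x /=; rewrite addrC. Qed.
Fact adjOp_add0 : left_id adjOp_zero adjOp_add.
Proof. by move=> S; apply: adjOp_eq => x /=; rewrite add0r. Qed.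
Fact adjOp_addN : left_inverse adjOp_zero adjOp_opp adjOp_add.
Proof. by move=> S; apply: adjOp_eq => x /=; rewrite addNr. Qed.
HB.instance Definition _ := GRing.isZmodule.Build (adjOp H)
  adjOp_addA adjOp_addC adjOp_add0 adjOp_addN.

Fact adjOp_mulA : associative adjOp_mul.
Proof. by move=> S T U; apply: adjOp_eq. Qed.
Fact adjOp_mulDl : left_distributive adjOp_mul +%R.
Proof. by move=> S T U; apply: adjOp_eq. Qed.
Fact adjOp_mulDr : right_distributive adjOp_mul +%R.
Proof. by move=> S T U; apply: adjOp_eq => x /=; rewrite adjOpD. Qed.
Fact adjOp_scaleA (k l : C) T :
  adjOp_scale k (adjOp_scale l T) = adjOp_scale (k * l) T.
Proof. by apply: adjOp_eq => x /=; rewrite scalerA. Qed.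
Fact adjOp_scale1 : left_id 1 adjOp_scale.
Proof. by move=> T; apply: adjOp_eq => x /=; rewrite scale1r. Qed.
Fact adjOp_scaleDr : right_distributive adjOp_scale +%R.
Proof. by move=> k S T; apply: adjOp_eq => x /=; rewrite scalerDr. Qed.
Fact adjOp_scaleDl T : {morph adjOp_scale^~ T : k l / k + l}.
Proof. by move=> k l; apply: adjOp_eq => x /=; rewrite scalerDl. Qed.
HB.instance Definition _ := GRing.Zmodule_isLmodule.Build C (adjOp H)
  adjOp_scaleA adjOp_scale1 adjOp_scaleDr adjOp_scaleDl.

Fact adjOp_mulZl (k : C) S T : adjOp_mul (k *: S) T = k *: adjOp_mul S T.
Proof. by apply: adjOp_eq. Qed.
Fact adjOp_mulZr (k : C) S T : adjOp_mul S (k *: T) = k *: adjOp_mul S T.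
Proof. by apply: adjOp_eq => x /=; rewrite adjOpZ. Qed.
Fact adjD S T : adj (S + T) = adj S + adj T.
Proof.
by apply: adj_unique => x y; rewrite /= innerDl innerDr !adj_funP.
Qed.
Fact adjZ (k : C) T : adj (k *: T) = k^* *: adj T.
Proof.
by apply: adj_unique => x y; rewrite /= innerZl innerZr conjCK adj_funP.
Qed.
Fact adjM S T : adj (adjOp_mul S T) = adjOp_mul (adj T) (adj S).
Proof. by apply: adj_unique => x y; rewrite /= !adj_funP. Qed.
Fact adjK : involutive adj.
Proof. by move=> T; apply: adj_unique => x y; rewrite /= adj_funPr. Qed.
HB.instance Definition _ := isStarAlgebra.Build C (adjOp H)
  adjOp_mulA adjOp_mulDl adjOp_mulDr adjOp_mulZl adjOp_mulZr adjD adjZ adjM adjK.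

Lemma adjOp_addE S T x : (S + T) x = S x + T x. Proof. by []. Qed.
Lemma adjOp_scaleE (k : C) T x : (k *: T) x = k *: T x. Proof. by []. Qed.
Lemma adjOp_mulE S T x : (S ** T) x = S (T x). Proof. by []. Qed.
Lemma adjOp_starP T : is_adjoint (star T) T. Proof. exact: adjP. Qed.
End AdjOp.

Definition starRep (C : numClosedFieldType) (A : starAlgType C)
  (H : preHilbertType C) := starHom A (adjOp H).

Definition closed_ideal (C : numClosedFieldType) (A : starAlgType C)
    (I : set A) :=
  exists (H : preHilbertType C) (pi : starRep A H), I = starHom_ker pi.

Record posFunctional (C : numClosedFieldType) (A : starAlgType C) :=
  PosFunctional {
    posf_fun :> {scalar A};
    posf_ge0 : forall a, 0 <= posf_fun (star a ** a)
  }.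

Section GNS.
Variables (C : numClosedFieldType) (A : starAlgType C) (w : posFunctional A).
Implicit Types (a b c : A) (k : C).

Definition gns_null : {pred A} := [pred a | w (star a ** a) == 0].

Lemma amul0r a : a ** 0 = 0.
Proof. by rewrite -[X in _ ** X](scale0r (0 : A)) amulZr scale0r. Qed.

Lemma amulBr a b c : a ** (b - c) = a ** b - a ** c.
Proof. by rewrite amulDr -scaleN1r amulZr scaleN1r. Qed.

Lemma posf_expand k a b :
  w (star (k *: a + b) ** (k *: a + b)) =
  (k^* * k) * w (star a ** a) + k^* * w (star a ** b)
  + (k * w (star b ** a) + w (star b ** b)).
Proof.
rewrite starD starZ amulDl !amulDr !amulZl !amulZr.
by rewrite !linearD !linearZ /= mulrA.
Qed.

Lemma posf_real a : (w (star a ** a))^* = w (star a ** a).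
Proof. by apply/CrealP/ger0_real; exact: posf_ge0. Qed.

Lemma posf_cross k a b : k * (w (star a ** b))^* + k^* * (w (star b ** a))^* =
  k^* * w (star a ** b) + k * w (star b ** a).
Proof.
have := posf_real (k *: a + b); rewrite posf_expand.
rewrite !rmorphD !rmorphM /= !posf_real conjCK => e.
apply: (addrI (k * k^* * w (star a ** a))).
apply: (addIr (w (star b ** b))).
by move: e; rewrite [k^* * k]mulrC !addrA.
Qed.

Lemma posf_conj a b : w (star b ** a) = (w (star a ** b))^*.
Proof.
have e1 := posf_cross 1 a b; rewrite rmorph1 !mul1r in e1.
have ei := posf_cross 'i a b; rewrite conjCi !mulNr -!mulrBr in ei.
have {}ei : (w (star a ** b))^* - (w (star b ** a))^* =
    w (star b ** a) - w (star a ** b).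
  by apply: (mulfI (neq0Ci C)); rewrite ei mulrBr addrC.
have : w (star b ** a) *+ 2 = (w (star a ** b))^* *+ 2.
  set P := (w (star a ** b))^*; set Q := (w (star b ** a))^*.
  have -> : P *+ 2 = (P + Q) + (P - Q) by ring.
  by rewrite e1 ei; ring.
by move/eqP; rewrite eqrMn2r /= => /eqP.
Qed.

Lemma gns_null_orth a b : a \in gns_null -> w (star b ** a) = 0.
Proof.
rewrite inE => /eqP a0; apply/eqP/negPn/negP => z0.
set z := w (star b ** a) in z0.
have zz : w (star a ** b) = z^* by rewrite posf_conj.
have nz : 0 < z^* * z by rewrite mulrC -normCK exprn_gt0 // normr_gt0.
pose t := (w (star b ** b) + 1) / (z^* * z).
have t_real : t^* = t.
  rewrite /t rmorphM fmorphV rmorphD rmorph1 /= posf_real rmorphM /= conjCK.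
  by rewrite [z * _]mulrC.
have := posf_ge0 w ((- t * z^*) *: a + b).
rewrite posf_expand a0 mulr0 add0r zz -/z.
rewrite rmorphM rmorphN /= t_real conjCK.
have -> : - t * z * z^* = - (w (star b ** b) + 1).
  by rewrite -mulrA [z * _]mulrC mulNr divfK // gt_eqF.
have -> : - t * z^* * z = - (w (star b ** b) + 1).
  by rewrite -mulrA mulNr divfK // gt_eqF.
rewrite addrC opprD -addrA.
have wb := posf_ge0 w b.
set B := w _ in wb *.
have -> : - B - 1 + (B + (- B - 1)) = - (B + 2) by ring.
by rewrite oppr_ge0 lt_geF // ltr_wpDl ?ltr0n.
Qed.

Lemma gns_null_closed : zmod_closed gns_null.
Proof.
split=> [|a b a0 b0]; first by rewrite inE amul0r linear0.
by rewrite inE amulBr linearB /= !gns_null_orth ?subr0.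
Qed.
HB.instance Definition _ := GRing.isZmodClosed.Build A gns_null gns_null_closed.

Lemma gns_nullZ k a : a \in gns_null -> k *: a \in gns_null.
Proof. by move=> a0; rewrite inE amulZr linearZ /= gns_null_orth ?mulr0. Qed.

Lemma gns_nullM a b : b \in gns_null -> a ** b \in gns_null.
Proof.
move=> b0; rewrite inE; have := gns_null_orth (star a ** (a ** b)) b0.
by rewrite !starM starK !amulA => ->.
Qed.

Definition gns_space := {ideal_quot gns_null}.
HB.instance Definition _ := GRing.Zmodule.on gns_space.

(* The class of a in A / gns_null, written psi_a in the literature.           *)
Definition gns_class a : gns_space := \pi_({ideal_quot gns_null}) a.

Lemma gns_class_eq a b : gns_class a = gns_class b <-> a - b \in gns_null.
Proof. by rewrite Quotient.idealrBE; split=> /eqP. Qed.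

Lemma gns_class_repr (x : gns_space) : gns_class (repr x) = x.
Proof. exact: reprK. Qed.

Lemma gns_classD a b : gns_class (a + b) = gns_class a + gns_class b.
Proof. exact: raddfD. Qed.

Definition gns_scale k (x : gns_space) : gns_space :=
  gns_class (k *: repr x).

Lemma gns_scale_class k a : gns_scale k (gns_class a) = gns_class (k *: a).
Proof.
apply/gns_class_eq; rewrite -scalerBr gns_nullZ //.
by apply/gns_class_eq; exact: gns_class_repr.
Qed.

Fact gns_scaleA k l x : gns_scale k (gns_scale l x) = gns_scale (k * l) x.
Proof. by rewrite -[x]gns_class_repr !gns_scale_class scalerA. Qed.
Fact gns_scale1 : left_id 1 gns_scale.
Proof. by move=> x; rewrite -[x]gns_class_repr gns_scale_class scale1r. Qed.
Fact gns_scaleDr : right_distributive gns_scale +%R.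
Proof.
move=> k x y; rewrite -[x]gns_class_repr -[y]gns_class_repr -gns_classD.
by rewrite !gns_scale_class scalerDr gns_classD.
Qed.
Fact gns_scaleDl x : {morph gns_scale^~ x : k l / k + l}.
Proof.
move=> k l; rewrite -[x]gns_class_repr !gns_scale_class scalerDl.
exact: gns_classD.
Qed.
HB.instance Definition _ := GRing.Zmodule_isLmodule.Build C gns_space
  gns_scaleA gns_scale1 gns_scaleDr gns_scaleDl.

Definition gns_inner (x y : gns_space) : C := w (star (repr x) ** repr y).

Lemma gns_inner_class a b :
  gns_inner (gns_class a) (gns_class b) = w (star a ** b).
Proof.
have repr_null c : repr (gns_class c) - c \in gns_null.
  by apply/gns_class_eq; exact: gns_class_repr.
transitivity (w (star (repr (gns_class a)) ** b)).
  apply/eqP; rewrite -subr_eq0 -linearB -amulBr /=.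
  by rewrite gns_null_orth.
rewrite posf_conj [RHS]posf_conj; congr (_ ^*).
by apply/eqP; rewrite -subr_eq0 -linearB -amulBr /= gns_null_orth.
Qed.

Fact gns_innerDr x y z : gns_inner x (y + z) = gns_inner x y + gns_inner x z.
Proof.
rewrite -[x]gns_class_repr -[y]gns_class_repr -[z]gns_class_repr -gns_classD.
by rewrite !gns_inner_class amulDr linearD.
Qed.
Fact gns_innerZr k (x y : gns_space) : gns_inner x (k *: y) = k * gns_inner x y.
Proof.
rewrite -[x]gns_class_repr -[y]gns_class_repr [k *: _]gns_scale_class.
by rewrite !gns_inner_class amulZr linearZ.
Qed.
Fact gns_inner_conj x y : gns_inner y x = (gns_inner x y)^*.
Proof.
rewrite -[x]gns_class_repr -[y]gns_class_repr !gns_inner_class.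
exact: posf_conj.
Qed.
Fact gns_inner_gt0 (x : gns_space) : x != 0 -> 0 < gns_inner x x.
Proof.
rewrite -[x]gns_class_repr gns_inner_class lt0r posf_ge0 andbT.
apply: contraNneq => x0; rewrite -(raddf0 (\pi_({ideal_quot gns_null}))).
by apply/eqP/gns_class_eq; rewrite subr0 inE x0.
Qed.
HB.instance Definition _ := isPreHilbert.Build C gns_space
  gns_innerDr gns_innerZr gns_inner_conj gns_inner_gt0.

Definition gns_op_fun a (x : gns_space) : gns_space := gns_class (a ** repr x).

Lemma gns_op_fun_class a b : gns_op_fun a (gns_class b) = gns_class (a ** b).
Proof.
apply/gns_class_eq; rewrite -amulBr gns_nullM //.
by apply/gns_class_eq; exact: gns_class_repr.
Qed.

Lemma gns_op_adjoint a : is_adjoint (gns_op_fun (star a)) (gns_op_fun a).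
Proof.
move=> x y; rewrite -[x]gns_class_repr -[y]gns_class_repr !gns_op_fun_class.
rewrite [LHS]gns_inner_class [RHS]gns_inner_class.
by rewrite starM starK amulA.
Qed.

Lemma gns_op_subproof a : `[< adjointable (gns_op_fun a) >].
Proof.
apply/asboolP; split; last by exists (gns_op_fun (star a)); exact: gns_op_adjoint.
move=> k x y; rewrite -[x]gns_class_repr -[y]gns_class_repr.
rewrite [k *: gns_class _]gns_scale_class -gns_classD !gns_op_fun_class.
by rewrite [k *: gns_class _]gns_scale_class -gns_classD amulDr amulZr.
Qed.

Definition gns_op a : adjOp gns_space := AdjOp (gns_op_subproof a).

Lemma gns_op_class a b : gns_op a (gns_class b) = gns_class (a ** b).
Proof. exact: gns_op_fun_class. Qed.

Fact gns_opD a b : gns_op (a + b) = gns_op a + gns_op b.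
Proof.
apply: adjOp_eq => x; rewrite -[x]gns_class_repr adjOp_addE.
by rewrite !gns_op_class amulDl gns_classD.
Qed.
Fact gns_opZ k a : gns_op (k *: a) = k *: gns_op a.
Proof.
apply: adjOp_eq => x; rewrite -[x]gns_class_repr adjOp_scaleE.
by rewrite !gns_op_class amulZl [RHS]gns_scale_class.
Qed.
Fact gns_opM a b : gns_op (a ** b) = gns_op a ** gns_op b.
Proof.
apply: adjOp_eq => x; rewrite -[x]gns_class_repr.
by rewrite adjOp_mulE !gns_op_class amulA.
Qed.
Fact gns_op_star a : gns_op (star a) = star (gns_op a).
Proof. by apply/esym/adj_unique; exact: gns_op_adjoint. Qed.

Definition gns_rep : starRep A gns_space :=
  StarHom gns_opD gns_opZ gns_opM gns_op_star.
End GNS.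

Section Smooth.
Variables (R : realType) (n : nat).

Definition partial (i : 'I_n) (f : 'rV[R]_n -> R) : 'rV[R]_n -> R :=
  fun x => 'D_(delta_mx 0 i) f x.

(* All partial derivatives up to order k exist and are continuous on U, which *)
(* is meant to be open.                                                       *)
Fixpoint Ck_on (k : nat) (U : set 'rV[R]_n) (f : 'rV[R]_n -> R) : Prop :=
  (forall x, U x -> {for x, continuous f}) /\
  if k is k'.+1 then
    forall i : 'I_n, (forall x, U x -> derivable f x (delta_mx 0 i)) /\
                     Ck_on k' U (partial i f)
  else True.

Definition smooth_on (U : set 'rV[R]_n) (f : 'rV[R]_n -> R) :=
  forall k, Ck_on k U f.

(* [chart_map] and [chart_inv] only matter on [chart_dom] and [chart_img].    *)
Record chart (M : topologicalType) := Chart {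
  chart_dom : set M;
  chart_map : M -> 'rV[R]_n;
  chart_inv : 'rV[R]_n -> M;
  chart_img := chart_map @` chart_dom;
  chart_dom_open : open chart_dom;
  chart_img_open : open chart_img;
  chart_mapK : forall x, chart_dom x -> chart_inv (chart_map x) = x;
  chart_map_continuous : {within chart_dom, continuous chart_map};
  chart_inv_continuous : {within chart_img, continuous chart_inv}
}.

Definition smooth_transition (M : topologicalType) (c d : chart M) :=
  forall j : 'I_n,
    smooth_on (chart_map c @` (chart_dom c `&` chart_dom d))
              (fun y => chart_map d (chart_inv c y) 0 j).

Lemma Ck_on_continuous k U f x : Ck_on k U f -> U x -> {for x, continuous f}.
Proof. by case: k => [|k] [fc _]; exact: fc. Qed.

Lemma Ck_onW k U f : Ck_on k.+1 U f -> Ck_on k U f.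
Proof.
elim: k f => [|k IH] f [fc df]; first by split.
by split=> // i; have [dfi /IH] := df i.
Qed.

Lemma Ck_on_ext k U f g : open U -> (forall x, U x -> f x = g x) ->
  Ck_on k U f -> Ck_on k U g.
Proof.
move=> oU; elim: k f g => [|k IH] f g fg [fc df];
  have fgn x (Ux : U x) : \near x, f x = g x by
    apply: (filterS fg); exact: open_nbhs_nbhs.
all: have gc x : U x -> {for x, continuous g}.
1,3: move=> Ux; rewrite /prop_for /continuous_at -(fg x Ux); apply: cvg_trans (fc x Ux).
all: try exact: (near_eq_cvg (fgn x Ux)).
  by split.
split=> // i; have [dfi Cfi] := df i; split=> [x Ux|].
  exact: near_eq_derivable (fgn x Ux) (dfi x Ux).
by apply: IH Cfi => x Ux; exact: near_eq_derive (fgn x Ux).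
Qed.

Lemma Ck_on_cst k U (a : R) : Ck_on k U (cst a).
Proof.
elim: k a => [|k IH] a; split=> //; try by move=> x _; exact: cst_continuous.
move=> i; split=> [x _|]; first exact: derivable_cst.
by rewrite (_ : partial i (cst a) = cst 0)//; apply/funext => x; exact: derive_cst.
Qed.

Lemma Ck_onD k U f g : open U -> Ck_on k U f -> Ck_on k U g ->
  Ck_on k U (fun x => f x + g x).
Proof.
move=> oU; elim: k f g => [|k IH] f g Cf Cg.
  by split=> // x Ux; apply: continuousD; apply: Ck_on_continuous Ux; eassumption.
split=> [x Ux|i].
  by apply: continuousD; apply: Ck_on_continuous Ux; eassumption.
have [_ /(_ i)[df Cdf]] := Cf; have [_ /(_ i)[dg Cdg]] := Cg.
split=> [x Ux|]; first by apply: derivableD; [exact: df|exact: dg].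
apply: Ck_on_ext oU _ (IH _ _ Cdf Cdg) => x Ux.
by rewrite [RHS](deriveD (df x Ux) (dg x Ux)).
Qed.

Lemma Ck_onM k U f g : open U -> Ck_on k U f -> Ck_on k U g ->
  Ck_on k U (fun x => f x * g x).
Proof.
move=> oU; elim: k f g => [|k IH] f g Cf Cg.
  by split=> // x Ux; apply: continuousM; apply: Ck_on_continuous Ux; eassumption.
split=> [x Ux|i].
  by apply: continuousM; apply: Ck_on_continuous Ux; eassumption.
have [_ /(_ i)[df Cdf]] := Cf; have [_ /(_ i)[dg Cdg]] := Cg.
split=> [x Ux|]; first by apply: derivableM; [exact: df|exact: dg].
have := Ck_onD oU (IH _ _ (Ck_onW Cf) Cdg) (IH _ _ (Ck_onW Cg) Cdf).
apply: Ck_on_ext oU _ => x Ux.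
by rewrite [RHS](deriveM (df x Ux) (dg x Ux)).
Qed.

Lemma smooth_on_cst U (a : R) : smooth_on U (fun=> a).
Proof. by move=> k; exact: Ck_on_cst. Qed.

Lemma smooth_onD U f g : open U -> smooth_on U f -> smooth_on U g ->
  smooth_on U (fun x => f x + g x).
Proof. by move=> oU Cf Cg k; exact: Ck_onD. Qed.

Lemma smooth_onM U f g : open U -> smooth_on U f -> smooth_on U g ->
  smooth_on U (fun x => f x * g x).
Proof. by move=> oU Cf Cg k; exact: Ck_onM. Qed.

Lemma smooth_onN U f : open U -> smooth_on U f -> smooth_on U (fun x => - f x).
Proof.
move=> oU Cf; under [X in smooth_on _ X]eq_fun do rewrite -mulN1r.
by apply: smooth_onM => //; exact: smooth_on_cst.
Qed.
End Smooth.

HB.mixin Record isSmoothManifold (R : realType) (n : nat) M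
    of Topological M := {
  manifold_hausdorff : hausdorff_space M;
  manifold_second_countable : @second_countable M;
  atlas : set (chart R n M);
  atlas_cover : forall x : M, exists2 c, atlas c & chart_dom c x;
  atlas_smooth : forall c d, atlas c -> atlas d -> smooth_transition c d
}.

#[short(type="smoothManifoldType")]
HB.structure Definition SmoothManifold (R : realType) (n : nat) :=
  {M of Topological M & isSmoothManifold R n M}.

Section Cinfty.
Variables (R : realType) (n : nat) (M : smoothManifoldType R n).
Local Notation C := (R[i]).

Definition smooth_fun (f : M -> C) :=
  forall c, @atlas R n M c ->
    smooth_on (chart_img c) (fun y => complex.Re (f (chart_inv c y))) /\
    smooth_on (chart_img c) (fun y => complex.Im (f (chart_inv c y))).

Record Cinfty := MkCinfty {
  Cinfty_fun :> M -> C;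
  CinftyP : `[< smooth_fun Cinfty_fun >]
}.

HB.instance Definition _ := [isSub for Cinfty_fun].
HB.instance Definition _ := [Choice of Cinfty by <:].

Lemma Cinfty_smooth (f : Cinfty) : smooth_fun f.
Proof. by case: f => f /= /asboolP. Qed.

Lemma Cinfty_eq (f g : Cinfty) : (forall x, f x = g x) -> f = g.
Proof. by move=> fg; apply: val_inj; apply/funext. Qed.

Lemma smooth_fun_cst (z : C) : `[< smooth_fun (fun=> z) >].
Proof. by apply/asboolP => c _; split; exact: smooth_on_cst. Qed.

Lemma smooth_funD (f g : Cinfty) : `[< smooth_fun (fun x => f x + g x) >].
Proof.
apply/asboolP => c ac.
have [f1 f2] := Cinfty_smooth f ac; have [g1 g2] := Cinfty_smooth g ac.
have oU := @chart_img_open R n M c; split.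
  under [X in smooth_on _ X]eq_fun do rewrite raddfD /=.
  exact: smooth_onD.
under [X in smooth_on _ X]eq_fun do rewrite raddfD /=.
exact: smooth_onD.
Qed.

Lemma smooth_funM (f g : Cinfty) : `[< smooth_fun (fun x => f x * g x) >].
Proof.
apply/asboolP => c ac.
have [f1 f2] := Cinfty_smooth f ac; have [g1 g2] := Cinfty_smooth g ac.
have oU := @chart_img_open R n M c.
have ReM (z t : C) : complex.Re (z * t) =
    complex.Re z * complex.Re t + - (complex.Im z * complex.Im t).
  by case: z; case: t.
have ImM (z t : C) : complex.Im (z * t) =
    complex.Re z * complex.Im t + complex.Im z * complex.Re t.
  by case: z; case: t.
split.
  under [X in smooth_on _ X]eq_fun do rewrite ReM.
  by apply: smooth_onD => //; [|apply: smooth_onN => //]; exact: smooth_onM.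
under [X in smooth_on _ X]eq_fun do rewrite ImM.
by apply: smooth_onD => //; exact: smooth_onM.
Qed.

Lemma smooth_fun_conj (f : Cinfty) : `[< smooth_fun (fun x => (f x)^*) >].
Proof.
apply/asboolP => c ac; have [f1 f2] := Cinfty_smooth f ac.
have oU := @chart_img_open R n M c.
have ReC (z : C) : complex.Re z^* = complex.Re z by case: z.
have ImC (z : C) : complex.Im z^* = - complex.Im z by case: z.
split; first by under [X in smooth_on _ X]eq_fun do rewrite ReC.
by under [X in smooth_on _ X]eq_fun do rewrite ImC; exact: smooth_onN.
Qed.

Definition Cinfty_cst z := MkCinfty (smooth_fun_cst z).
Definition Cinfty_add f g := MkCinfty (smooth_funD f g).
Definition Cinfty_mul f g := MkCinfty (smooth_funM f g).
Definition Cinfty_conj f := MkCinfty (smooth_fun_conj f).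
Definition Cinfty_scale z f := Cinfty_mul (Cinfty_cst z) f.
Definition Cinfty_opp f := Cinfty_scale (-1) f.

Fact Cinfty_addA : associative Cinfty_add.
Proof. by move=> f g h; apply: Cinfty_eq => x /=; rewrite addrA. Qed.
Fact Cinfty_addC : commutative Cinfty_add.
Proof. by move=> f g; apply: Cinfty_eq => x /=; rewrite addrC. Qed.
Fact Cinfty_add0 : left_id (Cinfty_cst 0) Cinfty_add.
Proof. by move=> f; apply: Cinfty_eq => x /=; rewrite add0r. Qed.
Fact Cinfty_addN : left_inverse (Cinfty_cst 0) Cinfty_opp Cinfty_add.
Proof. by move=> f; apply: Cinfty_eq => x /=; rewrite mulN1r addNr. Qed.
HB.instance Definition _ := GRing.isZmodule.Build Cinfty
  Cinfty_addA Cinfty_addC Cinfty_add0 Cinfty_addN.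

Fact Cinfty_scaleA z t f :
  Cinfty_scale z (Cinfty_scale t f) = Cinfty_scale (z * t) f.
Proof. by apply: Cinfty_eq => x /=; rewrite mulrA. Qed.
Fact Cinfty_scale1 : left_id 1 Cinfty_scale.
Proof. by move=> f; apply: Cinfty_eq => x /=; rewrite mul1r. Qed.
Fact Cinfty_scaleDr : right_distributive Cinfty_scale +%R.
Proof. by move=> z f g; apply: Cinfty_eq => x /=; rewrite mulrDr. Qed.
Fact Cinfty_scaleDl f : {morph Cinfty_scale^~ f : z t / z + t}.
Proof. by move=> z t; apply: Cinfty_eq => x /=; rewrite mulrDl. Qed.
HB.instance Definition _ := GRing.Zmodule_isLmodule.Build C Cinfty
  Cinfty_scaleA Cinfty_scale1 Cinfty_scaleDr Cinfty_scaleDl.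

Fact Cinfty_mulA : associative Cinfty_mul.
Proof. by move=> f g h; apply: Cinfty_eq => x /=; rewrite mulrA. Qed.
Fact Cinfty_mulDl : left_distributive Cinfty_mul +%R.
Proof. by move=> f g h; apply: Cinfty_eq => x /=; rewrite mulrDl. Qed.
Fact Cinfty_mulDr : right_distributive Cinfty_mul +%R.
Proof. by move=> f g h; apply: Cinfty_eq => x /=; rewrite mulrDr. Qed.
Fact Cinfty_mulZl z f g : Cinfty_mul (z *: f) g = z *: Cinfty_mul f g.
Proof. by apply: Cinfty_eq => x /=; rewrite mulrA. Qed.
Fact Cinfty_mulZr z f g : Cinfty_mul f (z *: g) = z *: Cinfty_mul f g.
Proof. by apply: Cinfty_eq => x /=; rewrite mulrCA. Qed.
Fact Cinfty_conjD f g : Cinfty_conj (f + g) = Cinfty_conj f + Cinfty_conj g.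
Proof. by apply: Cinfty_eq => x /=; rewrite rmorphD. Qed.
Fact Cinfty_conjZ (z : C) f : Cinfty_conj (z *: f) = z^* *: Cinfty_conj f.
Proof. by apply: Cinfty_eq => x /=; rewrite rmorphM. Qed.
Fact Cinfty_conjM f g :
  Cinfty_conj (Cinfty_mul f g) = Cinfty_mul (Cinfty_conj g) (Cinfty_conj f).
Proof. by apply: Cinfty_eq => x /=; rewrite rmorphM mulrC. Qed.
Fact Cinfty_conjK : involutive Cinfty_conj.
Proof. by move=> f; apply: Cinfty_eq => x /=; rewrite conjCK. Qed.
HB.instance Definition _ := isStarAlgebra.Build C Cinfty
  Cinfty_mulA Cinfty_mulDl Cinfty_mulDr Cinfty_mulZl Cinfty_mulZr
  Cinfty_conjD Cinfty_conjZ Cinfty_conjM Cinfty_conjK.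

Lemma CinftyDE (f g : Cinfty) x : (f + g) x = f x + g x. Proof. by []. Qed.
Lemma CinftyZE (z : C) (f : Cinfty) x : (z *: f) x = z * f x.
Proof. by []. Qed.
Lemma CinftyME (f g : Cinfty) x : (f ** g) x = f x * g x. Proof. by []. Qed.
Lemma Cinfty_starE (f : Cinfty) x : (star f) x = (f x)^*. Proof. by []. Qed.

Definition vanishing_ideal (F : set M) : set Cinfty :=
  [set f : Cinfty | forall x, F x -> f x = 0].
End Cinfty.

(* Main.v *)
Require Import Defs.
From HB Require Import structures.
From mathcomp Require Import all_boot all_order all_algebra.
From mathcomp Require Import ring lra finmap.
From mathcomp Require Import complex.
From mathcomp Require Import all_classical all_reals all_analysis.
Set Implicit Arguments.
Unset Strict Implicit.
Unset Printing Implicit Defensive.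
Import Order.TTheory GRing.Theory Num.Theory numFieldNormedType.Exports.
Local Open Scope classical_set_scope.
Local Open Scope ring_scope.

(* Let F be the set of common zeros of the kernel of a representation and let *)
(* w be one of its vector functionals. If f vanishes on F and g = |f|^2, fix  *)
(* a smooth proper function p >= 0. Where p > 1/e we have g <= e p g, and by  *)
(* compactness of {p <= 1/e} there are finitely many a in the kernel with     *)
(* g <= e + sum |a|^2 there. As w kills |a|^2 and is monotone (square roots   *)
(* of positive smooth functions are smooth), w(g) <= e (w(1) + w(p g)) for    *)
(* every e > 0, so w(g) = 0. Hence closed ideals are vanishing ideals; the    *)
(* converse uses multiplication operators on finitely supported functions.    *)
(* If the kernel is that of the GNS representation of w and p is unbounded on *)
(* F, then for each N some smooth u_N >= 0 vanishing on {p <= N} has          *)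
(* w(u_N^2) = 1, and w of the locally finite sum of the u_N^2 would be        *)
(* infinite; so F is compact. Conversely, for x_k dense in a compact set K    *)
(* the functional f |-> sum_k 2^-k f(x_k) has GNS kernel I_K.                 *)

(** Everything is read off vector functionals: [pi f] vanishes iff w(|f|^2) = 0 for each w of the
    form a |-> <v, pi(a) v>, and every positive functional is monotone on real smooth functions
    ([rpart_le]). From monotonicity alone, [posf_zeros] shows that a w killing |a|^2 for all a in
    the kernel kills |f|^2 for all f vanishing on the common zeros. No continuity of w is available,
    so infinity is controlled by the proper function p of [exhaustion_exists]: the price is the
    number w(p |f|^2), finite because w is defined on all smooth functions. This gives
    [ker_rep_vanishing]; [point_rep_ker] is the converse.

    For GNS representations, commutativity and the unit identify the kernel with the null space of w
    ([gns_ker]). [zeros_bounded] then confines the zero set to a sublevel set of p, whence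
    [gns_zeros_compact]; conversely [compact_gns] integrates over K against point masses at a dense
    sequence. *)

Section SmoothCalculus.
Variables (R : realType) (n : nat).
Implicit Types (U V : set 'rV[R]_n) (f : 'rV[R]_n -> R).

Lemma Ck_on_sub k U V f : V `<=` U -> Ck_on k U f -> Ck_on k V f.
Proof.
move=> VU; elim: k f => [|k IH] f [fc df]; split=> //; try by move=> x /VU /fc.
by move=> i; have [dfi Cfi] := df i; split; [move=> x /VU /dfi|exact: IH].
Qed.

(** [V] may be any set: [Ck_on] asks for continuity and derivatives in the ambient space, point by
    point. *)
Lemma Ck_on_local k U f :
  (forall x, U x -> exists2 V, V x & Ck_on k V f) -> Ck_on k U f.
Proof.
elim: k f => [|k IH] f H; split=> //.
- by move=> x /H [V Vx [fc _]]; exact: fc.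
- by move=> x /H [V Vx [fc _]]; exact: fc.
move=> i; split=> [x /H [V Vx [_ /(_ i)[df _]]]|]; first exact: df.
by apply: IH => x /H [V Vx [_ /(_ i)[_ Cf]]]; exists V.
Qed.

Lemma smooth_on_sub U V f : V `<=` U -> smooth_on U f -> smooth_on V f.
Proof. by move=> VU Cf k; exact: Ck_on_sub (Cf k). Qed.

Lemma smooth_on_ext U f g : open U -> (forall x, U x -> f x = g x) ->
  smooth_on U f -> smooth_on U g.
Proof. by move=> oU fg Cf k; exact: Ck_on_ext oU fg (Cf k). Qed.

Lemma smooth_on_local U f :
  (forall x, U x -> exists2 V, V x & smooth_on V f) -> smooth_on U f.
Proof.
by move=> H k; apply: Ck_on_local => x /H[V Vx Cf]; exists V => //; exact: Cf.
Qed.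

Lemma smooth_on_prod (I : Type) (s : seq I) U (f : I -> 'rV[R]_n -> R) :
  open U -> (forall i, smooth_on U (f i)) ->
  smooth_on U (fun x => \prod_(i <- s) f i x).
Proof.
move=> oU Cf; elim: s => [|i s IH].
  by under [X in smooth_on _ X]eq_fun do rewrite big_nil; exact: smooth_on_cst.
by under [X in smooth_on _ X]eq_fun do rewrite big_cons; exact: smooth_onM.
Qed.

(** Restricting to the line t |-> t v + x reduces this to the one-variable chain rule at t = 0. *)
Lemma is_derive_comp1 (g : R -> R) f x v (dg : R) :
  is_derive (f x) 1 g dg -> derivable f x v ->
  is_derive x v (g \o f) (dg * 'D_v f x).
Proof.
move=> gd /derivable1P fd.
have fx : f (0 *: v + x) = f x by rewrite scale0r add0r.
have E (h : 'rV[R]_n -> R) : 'D_v h x = 'D_1 (fun t : R => h (t *: v + x)) 0.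
  rewrite /derive; set g1 := fun h => h^-1 *: _; set g2 := fun h => h^-1 *: _.
  suff -> : g1 = g2 by [].
  by apply/funext => t; rewrite /g1 /g2 /= addr0 scale0r add0r [_%:A]mulr1.
have gd' : is_derive ((fun t : R => f (t *: v + x)) 0) 1 g dg.
  by rewrite /= fx.
have [d1 d2] := is_derive1_comp gd' (derivableP fd).
split; first exact/(@derivable1P _ _ _ (g \o f)).
by rewrite E (E f).
Qed.

(* The shape of the derivatives is that of both [Num.sqrt t * t ^- m] and     *)
(* [t ^- m * expR (- t^-1)].                                                  *)
Lemma smooth_on_comp (g : nat -> R -> R) (a b : nat -> R) (D : set R) U f :
  (forall m t, D t ->
     is_derive t 1 (g m) (a m * g m.+1 t + b m * g m.+2 t)) ->
  open U -> (forall x, U x -> D (f x)) -> smooth_on U f ->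
  forall m, smooth_on U (g m \o f).
Proof.
(* The derivative of [g m] involves [g m.+1] and [g m.+2], so the induction on the order [k] must
   treat all [m] at once. *)
move=> dg oU UD Cf m k; elim: k m => [|k IH] m.
  split=> // x Ux; apply: continuous_comp; first exact: Ck_on_continuous (Cf 0) Ux.
  by apply/differentiable_continuous/derivable1_diffP; have [] := dg m _ (UD x Ux).
split=> [x Ux|i].
  apply: continuous_comp; first exact: Ck_on_continuous (Cf 0) Ux.
  by apply/differentiable_continuous/derivable1_diffP; have [] := dg m _ (UD x Ux).
have [_ /(_ i)[df Cdf]] := Cf k.+1.
split=> [x Ux|].
  by have [] := is_derive_comp1 (dg m _ (UD x Ux)) (df x Ux).
have C1 : Ck_on k U (fun x => (a m * g m.+1 (f x) + b m * g m.+2 (f x))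
                              * partial i f x).
  apply: Ck_onM => //; apply: Ck_onD => //; apply: Ck_onM => //;
    try exact: Ck_on_cst; exact: IH.
apply: Ck_on_ext oU _ C1 => x Ux.
by have [_ d] := is_derive_comp1 (dg m _ (UD x Ux)) (df x Ux); exact: esym d.
Qed.

Lemma is_derive_exprNn (m : nat) (t : R) : 0 < t ->
  is_derive t 1 (fun t => t ^- m) (- m%:R * t ^- m.+1).
Proof.
move=> t0.
have dX : is_derive t 1 (fun t : R => t ^+ m) (m%:R * t ^+ m.-1).
  split; first exact: exprn_derivable.
  by rewrite exp_derive /GRing.scale/= mulr1.
have tm : t ^+ m != 0 by rewrite expf_neq0 ?gt_eqF.
apply: (is_derive_eq (is_deriveV (f := fun t => t ^+ m) tm dX)).
case: m {dX} tm => [|m] tm; first by rewrite !mul0r scaler0 oppr0 mul0r.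
rewrite /GRing.scale/= !exprS; field.
by rewrite expf_neq0 ?gt_eqF.
Qed.

(** The term with coefficient 0 only brings the derivative into the shape that [smooth_on_comp]
    expects; the square root itself is the case m = 0. *)
Lemma is_derive_sqrtXV (m : nat) (t : R) : 0 < t ->
  is_derive t 1 (fun t => Num.sqrt t * t ^- m)
    ((2^-1 - m%:R) * (Num.sqrt t * t ^- m.+1)
      + 0 * (Num.sqrt t * t ^- m.+2)).
Proof.
move=> t0.
have d1 := is_derive1_sqrt t0.
have d2 := is_derive_exprNn m t0.
apply: (is_derive_eq (is_deriveM d1 d2)).
have s0 : 0 < Num.sqrt t by rewrite sqrtr_gt0.
rewrite mul0r addr0.
have -> : (2 * Num.sqrt t)^-1 = Num.sqrt t / (2 * t).
  by rewrite -{3}(sqr_sqrtr (ltW t0)); field; rewrite gt_eqF.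
rewrite /GRing.scale/= exprS; field.
by rewrite expf_neq0 ?gt_eqF.
Qed.

Lemma smooth_on_sqrt U f : open U -> (forall x, U x -> 0 < f x) ->
  smooth_on U f -> smooth_on U (fun x => Num.sqrt (f x)).
Proof.
move=> oU f0 Cf.
have := smooth_on_comp (g := fun m t => Num.sqrt t * t ^- m) (D := [set t | 0 < t])
  (fun m t t0 => is_derive_sqrtXV m t0) oU f0 Cf 0.
by congr smooth_on; apply/funext => x /=; rewrite expr0 invr1 mulr1.
Qed.

End SmoothCalculus.

(** * The flat function exp(-1/t) *)

Section FlatFunction.
Variable R : realType.

(** [flat 0] is the function of interest; the powers t^-m make the family closed under
    differentiation. *)
Definition flat (m : nat) (t : R) : R := if 0 < t then t ^- m * expR (- t^-1) else 0.

(** The exponential series gives exp(1/t) >= t^-(m+2) / (m+2)!. The order t^2 is what makes the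
    difference quotient at 0 tend to 0. *)
Lemma flat_bound m (t : R) : 0 <= t -> 0 <= flat m t <= m.+2`!%:R * t ^+ 2.
Proof.
rewrite le_eqVlt /flat => /predU1P[<-|t0]; first by rewrite ltxx expr0n mulr0 lexx.
rewrite t0 mulr_ge0 ?expR_ge0 ?invr_ge0 ?exprn_ge0 ?(ltW t0)//=.
have s0 : 0 < t^-1 by rewrite invr_gt0.
have := expR_ge1Dxn m.+1 (ltW s0).
rewrite expRN => H.
have {}H : t^-1 ^+ m.+2 / m.+2`!%:R <= expR t^-1 by apply: le_trans H; lra.
have f0 : 0 < m.+2`!%:R :> R by rewrite ltr0n fact_gt0.
rewrite ler_pdivrMr ?expR_gt0// -ler_pdivrMl; last by rewrite mulr_gt0 ?exprn_gt0.
apply: le_trans H; rewrite exprVn !exprS le_eqVlt; apply/orP; left; apply/eqP.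
field; rewrite (gt_eqF f0) expf_neq0 ?gt_eqF//.
Qed.

Lemma is_derive_flat m (t : R) :
  is_derive t 1 (flat m) (- m%:R * flat m.+1 t + 1 * flat m.+2 t).
Proof.
have [t0|t0|->] := ltgtP t 0.
- rewrite /flat (lt_gtF t0) !mulr0 addr0.
  apply: (@near_eq_is_derive _ _ _ (cst 0)).
  near=> x; have x0 : x < 0 by near: x; exact: lt_nbhsl.
  by rewrite (lt_gtF x0).
- have -> : - m%:R * flat m.+1 t + 1 * flat m.+2 t =
      t ^- m * (t ^- 2 * expR (- t^-1)) + expR (- t^-1) * (- m%:R * t ^- m.+1).
    rewrite /flat t0 !exprS expr0; field.
    by rewrite expf_neq0 ?gt_eqF.
  apply: (@near_eq_is_derive _ _ _ (fun t : R => t ^- m * expR (- t^-1))).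
    near=> x; have x0 : 0 < x by near: x; exact: lt_nbhsr.
    by rewrite /flat x0.
  have d1 := is_derive_exprNn m t0.
  have t1 : id t != 0 by rewrite gt_eqF.
  have d2 : is_derive t 1 (fun y : R => - y^-1) (t ^- 2).
    apply: (is_derive_eq (is_deriveN (is_deriveV (f := id) t1 (is_derive_id t 1)))).
    by rewrite scaleNr opprK [LHS]mulr1.
  have d3 : is_derive t 1 (fun y : R => expR (- y^-1)) (expR (- t^-1) * t ^- 2).
    exact: (is_derive1_comp (f := expR) (is_derive_expR _) d2).
  apply: (is_derive_eq (is_deriveM d1 d3)).
  by rewrite /GRing.scale/= [expR _ * t ^- 2]mulrC.
rewrite {2 3}/flat ltxx !mulr0 addr0.
(* At t = 0 the quotient is 0 on the left and at most (m+2)! h on the right. *)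
suff H : h^-1 *: ((flat m \o shift 0) (h *: 1) - flat m 0) @[h --> 0^'] --> 0.
  by split; [apply/cvg_ex; exists 0|exact: cvg_lim].
rewrite /flat ltxx -/(flat m).
apply/cvgr0Pnorm_lt => e e0.
near=> h => /=.
rewrite subr0 [_ *: 1]mulr1 addr0 -/(flat m h).
have [h0|h0] := leP h 0; first by rewrite /flat (le_gtF h0)/= scaler0 normr0.
have /andP[f1 f2] := flat_bound m (ltW h0).
rewrite ger0_norm ?mulr_ge0 ?invr_ge0 ?(ltW h0)//.
rewrite /GRing.scale/= mulrC ltr_pdivrMr//.
apply: le_lt_trans f2 _; rewrite expr2 mulrA ltr_pM2r//.
have f0 : 0 < m.+2`!%:R :> R by rewrite ltr0n fact_gt0.
rewrite -ltr_pdivlMl// mulrC; apply: le_lt_trans (ler_norm h) _.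
near: h; apply: dnbhs0_lt; exact: divr_gt0.
Unshelve. all: by end_near. Qed.

Lemma flat_gt0 (t : R) : (0 < flat 0 t) = (0 < t).
Proof.
by rewrite /flat; case: ifP => t0; rewrite ?ltxx// expr0 invr1 mul1r expR_gt0.
Qed.

Lemma flat_ge0 (t : R) : 0 <= flat 0 t.
Proof. by rewrite /flat; case: ifP => t0; rewrite ?expr0 ?invr1 ?mul1r ?expR_ge0. Qed.

Lemma flat_eq0 (t : R) : t <= 0 -> flat 0 t = 0.
Proof. by rewrite /flat ltNge => ->. Qed.

Lemma smooth_on_flat n (U : set 'rV[R]_n) f : open U ->
  smooth_on U f -> smooth_on U (fun x => flat 0 (f x)).
Proof.
move=> oU Cf.
exact: (smooth_on_comp (D := setT) (fun m t _ => is_derive_flat m t) oU _ Cf).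
Qed.
End FlatFunction.

(** * Real smooth functions on M, bumps and a proper function *)

Section RealSmooth.
Variables (R : realType) (n : nat) (M : smoothManifoldType R n).
Implicit Types (h : M -> R) (c : chart R n M).

Lemma chart_mapP c x : chart_dom c x -> chart_img c (chart_map c x).
Proof. by move=> cx; exists x. Qed.

Lemma chart_invP c y : chart_img c y -> chart_dom c (chart_inv c y).
Proof. by move=> [x cx <-]; rewrite chart_mapK. Qed.

Lemma chart_invK c y : chart_img c y -> chart_map c (chart_inv c y) = y.
Proof. by move=> [x cx <-]; rewrite chart_mapK. Qed.

Lemma chart_preimage_open c (V : set M) : open V ->
  open (chart_img c `&` chart_inv c @^-1` V).
Proof.
have oU := @chart_img_open R n M c.
move: V; apply/(continuous_inP _ oU); rewrite -continuous_open_subspace//.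
exact: chart_inv_continuous.
Qed.

Definition smoothR h := forall c, @atlas R n M c ->
  smooth_on (chart_img c) (h \o chart_inv c).

Lemma smoothR_cst (a : R) : smoothR (fun=> a).
Proof. by move=> c _; exact: smooth_on_cst. Qed.

Lemma smoothRD h1 h2 : smoothR h1 -> smoothR h2 ->
  smoothR (fun x => h1 x + h2 x).
Proof.
by move=> s1 s2 c ac; apply: smooth_onD (s1 c ac) (s2 c ac); exact: chart_img_open.
Qed.

Lemma smoothRM h1 h2 : smoothR h1 -> smoothR h2 ->
  smoothR (fun x => h1 x * h2 x).
Proof.
by move=> s1 s2 c ac; apply: smooth_onM (s1 c ac) (s2 c ac); exact: chart_img_open.
Qed.

Lemma smoothRZ (a : R) h : smoothR h -> smoothR (fun x => a * h x).
Proof. exact/smoothRM/smoothR_cst. Qed.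

Lemma smoothRN h : smoothR h -> smoothR (fun x => - h x).
Proof. by move=> s c ac; apply: smooth_onN (s c ac); exact: chart_img_open. Qed.

Lemma smoothRB h1 h2 : smoothR h1 -> smoothR h2 ->
  smoothR (fun x => h1 x - h2 x).
Proof. by move=> s1 s2; exact: smoothRD s1 (smoothRN s2). Qed.

Lemma smoothR_sum (I : Type) (s : seq I) (h : I -> M -> R) :
  (forall i, smoothR (h i)) -> smoothR (fun x => \sum_(i <- s) h i x).
Proof.
move=> sh; elim: s => [|i s IH].
  by under [X in smoothR X]eq_fun do rewrite big_nil; exact: smoothR_cst.
by under [X in smoothR X]eq_fun do rewrite big_cons; exact: smoothRD.
Qed.

Lemma smoothR_prod (I : Type) (s : seq I) (h : I -> M -> R) :
  (forall i, smoothR (h i)) -> smoothR (fun x => \prod_(i <- s) h i x).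
Proof.
move=> sh c ac; apply: smooth_on_prod; first exact: chart_img_open.
by move=> i; exact: sh.
Qed.

Lemma smoothR_sqrt h : (forall x, 0 < h x) -> smoothR h ->
  smoothR (fun x => Num.sqrt (h x)).
Proof.
move=> h0 sh c ac; apply: (smooth_on_sqrt (f := h \o chart_inv c)).
- exact: chart_img_open.
- by move=> y _; exact: h0.
- exact: sh.
Qed.

Lemma smoothR_flat h : smoothR h -> smoothR (fun x => flat 0 (h x)).
Proof.
move=> sh c ac; apply: (smooth_on_flat (f := h \o chart_inv c)); last exact: sh.
exact: chart_img_open.
Qed.

Lemma smoothR_local h :
  (forall x, exists V g, [/\ open V, V x, smoothR g & forall y, V y -> h y = g y]) ->
  smoothR h.
Proof.
move=> H c ac; apply: smooth_on_local => y cy.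
have [V [g [oV Vx sg hg]]] := H (chart_inv c y).
exists (chart_img c `&` chart_inv c @^-1` V) => //.
have oW := chart_preimage_open (c := c) oV.
apply: (smooth_on_ext (f := g \o chart_inv c)) => //.
  by move=> z [_ /hg /= ->].
by apply: smooth_on_sub (sg c ac) => z [].
Qed.

Lemma smoothR_continuous h : smoothR h -> continuous h.
Proof.
move=> sh x; have [c ac cx] := @atlas_cover R n M x.
have /= [hc _] := sh c ac 0; have oD := @chart_dom_open R n M c.
have := @chart_map_continuous R n M c.
rewrite continuous_open_subspace// => /(_ x (mem_set cx)) mc.
have H : (fun y => h (chart_inv c (chart_map c y))) @ x --> h (chart_inv c (chart_map c x)).
  exact: continuous_comp mc (hc _ (chart_mapP cx)).
rewrite (chart_mapK cx) in H; rewrite /continuous_at.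
apply: cvg_trans H; apply: near_eq_cvg.
by apply: (filterS _ (open_nbhs_nbhs (conj oD cx))) => y cy /=; rewrite chart_mapK.
Qed.

(** In a chart, take a product of flat functions, one per coordinate, supported in a small closed
    box, and extend it by 0. The image [K] of the box is compact, hence closed since M is Hausdorff,
    so the extension is smooth. *)
Lemma bump_exists (x : M) : exists h K,
  [/\ smoothR h, forall y, 0 <= h y, 1 < h x, compact K &
      forall y, ~ K y -> h y = 0].
Proof.
have [c ac cx] := @atlas_cover R n M x.
set a := chart_map c x.
have /nbhs_ballP[e /= e0 ae] : nbhs a (chart_img c).
  by apply: open_nbhs_nbhs; split; [exact: chart_img_open|exact: chart_mapP].
pose r := e / 2.
have r0 : 0 < r by rewrite divr_gt0.
pose B := [set y : 'rV[R]_n | forall i, `[a 0 i - r, a 0 i + r]%classic (y 0 i)].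
have Bimg : B `<=` chart_img c.
  move=> y By; apply: ae; split=> // i j; rewrite (ord1 i) /ball /=.
  have := By j; rewrite /= in_itv /= => /andP[y1 y2].
  by rewrite ltr_distl; apply/andP; move: r0; rewrite /r in y1 y2 *; split; lra.
have cB : compact B.
  exact: (@rV_compact R n (fun i => `[a 0 i - r, a 0 i + r]%classic)
           (fun i => @segment_compact R _ _)).
pose K := chart_inv c @` B.
have cK : compact K.
  apply: continuous_compact cB.
  exact: continuous_subspaceW Bimg (@chart_inv_continuous R n M c).
have Kcl : closed K := compact_closed (@manifold_hausdorff R n M) cK.
pose q i (y : R) := r ^+ 2 - (y - a 0 i) ^+ 2.
pose h y := if y \in chart_dom c then
              \prod_i flat 0 (q i (chart_map c y 0 i)) else 0.
have h0 y : 0 <= h y.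
  by rewrite /h; case: ifP => // _; apply: prodr_ge0 => i _; exact: flat_ge0.
have hK y : ~ K y -> h y = 0.
  move=> nK; rewrite /h; case: ifPn => // /set_mem cy.
  have : exists i, r ^+ 2 < (chart_map c y 0 i - a 0 i) ^+ 2.
    apply: contrapT => /forallNP H; apply: nK; exists (chart_map c y); last exact: chart_mapK.
    move=> i; have /negP := H i; rewrite -leNgt => {}H.
    have : `|chart_map c y 0 i - a 0 i| <= r.
      by rewrite -(ger0_norm (ltW r0)) -ler_sqr ?nnegrE// !real_normK ?num_real.
    by rewrite /= in_itv /= ler_distl.
  move=> [i Hi]; rewrite (bigD1 i) //= flat_eq0 ?mul0r// /q.
  by rewrite subr_le0 ltW.
have hx : 0 < h x.
  rewrite /h mem_set//; apply: prodr_gt0 => i _; rewrite flat_gt0 /q subrr expr0n subr0.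
  exact: exprn_gt0.
have sh : smoothR h.
  move=> d ad; apply: smooth_on_local => y dy.
  have [cy|ncy] := pselect (chart_dom c (chart_inv d y)).
    (* Inside the domain of [c], [h] is the product formula composed with the transition map from
       [d] to [c]. *)
    pose V := chart_img d `&` chart_inv d @^-1` chart_dom c.
    have oV : open V by apply: chart_preimage_open; exact: chart_dom_open.
    exists V => //.
    apply: (smooth_on_ext (f := fun z => \prod_i
        flat 0 (q i (chart_map c (chart_inv d z) 0 i)))) => //.
      by move=> z [_ /= cz]; rewrite /h mem_set.
    apply: smooth_on_prod => // i; apply: smooth_on_flat => //.
    have st : smooth_on V (fun z => chart_map c (chart_inv d z) 0 i).
      apply: smooth_on_sub (@atlas_smooth R n M d c ad ac i) => z [dz cz].
      exists (chart_inv d z); last exact: chart_invK.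
      by split=> //; exact: chart_invP.
    rewrite /q; apply: smooth_onD => //; first exact: smooth_on_cst.
    apply: smooth_onN => //; under [X in smooth_on _ X]eq_fun do rewrite expr2.
    by apply: smooth_onM => //; apply: smooth_onD => //; exact: smooth_on_cst.
  (* A point outside the domain of [c] lies in the open complement of [K], where [h] is 0. *)
  pose V := chart_img d `&` chart_inv d @^-1` (~` K).
  have oV : open V by apply: chart_preimage_open; exact: closed_openC.
  exists V.
    by split=> // -[z Bz zy]; apply: ncy; rewrite -zy; exact/chart_invP/Bimg.
  apply: (smooth_on_ext (f := fun=> 0)) => //; last exact: smooth_on_cst.
  by move=> z [_ /= Kz]; rewrite hK.
exists (fun y => 2 / h x * h y), K; split=> //.
- exact: smoothRZ.
- by move=> y; rewrite mulr_ge0// divr_ge0// ltW.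
- by rewrite divfK ?gt_eqF// ltr1n.
- by move=> y /hK ->; rewrite mulr0.
Qed.

(** The sum is cut off at a bound chosen for each point; the value does not depend on the bound, so
    near each point it is one fixed finite sum. *)
Lemma smoothR_locally_finite (u : nat -> M -> R) :
  (forall k, smoothR (u k)) ->
  (forall x : M, exists N, \forall y \near x, forall k, (N <= k)%N -> u k y = 0) ->
  exists2 g, smoothR g &
    forall x N, (forall k, (N <= k)%N -> u k x = 0) ->
      g x = \sum_(k < N) u k x.
Proof.
move=> su lf.
have fin x : exists N, forall k, (N <= k)%N -> u k x = 0.
  by have [N /nbhs_singleton H] := lf x; exists N.
pose g x := \sum_(k < sval (cid (fin x))) u k x.
have gE x N : (forall k, (N <= k)%N -> u k x = 0) -> g x = \sum_(k < N) u k x.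
  rewrite /g; case: cid => /= N' H' H.
  have E m m' : (m <= m')%N -> (forall k, (m <= k)%N -> u k x = 0) ->
      \sum_(k < m') u k x = \sum_(k < m) u k x.
    move=> mm' z; rewrite -(subnKC mm') big_split_ord/= [X in _ + X]big1 ?addr0//.
    by move=> i _; rewrite z// leq_addr.
  by have [/E->//|/ltnW/E->] := leqP N N'.
exists g => //; apply: smoothR_local => x.
have [N xN] := lf x.
have : nbhs x [set y | forall k, (N <= k)%N -> u k y = 0] := xN.
rewrite nbhsE => -[V [oV Vx] VH].
exists V, (fun y => \sum_(k < N) u k y); split=> //.
  exact: smoothR_sum.
by move=> y Vy; apply: gE => k; exact: VH.
Qed.

Lemma bump_cover : exists (c : nat -> M -> R) (K : nat -> set M),
  [/\ forall k, smoothR (c k), forall k, compact (K k),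
      forall k y, ~ K k y -> c k y = 0 &
      forall x, exists k, 1 < c k x].
Proof.
have [B /pfcard_geP Bc [Bo Bb]] := @manifold_second_countable R n M.
(* The base can be empty only if M is. *)
have [E|/surjfunPex[s /= sE]] := Bc.
  have no (x : M) : False.
    by have [U [/=]] := Bb x setT filterT; rewrite E.
  exists (fun _ _ => 0), (fun=> set0); split => //; first by move=> _; exact: smoothR_cst.
  by move=> ?; exact: compact0.
(* If some compactly supported function exceeds 1 on all of [s k], the selected one does; otherwise
   the zero function is selected. *)
have H k : exists hK : (M -> R) * set M,
    [/\ smoothR hK.1, compact hK.2, forall y, ~ hK.2 y -> hK.1 y = 0 &
    forall hK' : (M -> R) * set M, smoothR hK'.1 -> compact hK'.2 ->
      (forall y, ~ hK'.2 y -> hK'.1 y = 0) ->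
      s k `<=` [set y | 1 < hK'.1 y] -> s k `<=` [set y | 1 < hK.1 y]].
  have [[hK [h1 h2 h3 h4]]|nE] := pselect (exists hK : (M -> R) * set M,
    [/\ smoothR hK.1, compact hK.2, forall y, ~ hK.2 y -> hK.1 y = 0 &
      s k `<=` [set y | 1 < hK.1 y]]).
    by exists hK; split.
  exists (fun=> 0, set0); split=> //=; first exact: smoothR_cst.
    exact: compact0.
  by move=> hK h1 h2 h3 h4; exfalso; apply: nE; exists hK.
have {H} /choice[f fP] := H.
exists (fun k => (f k).1), (fun k => (f k).2); split.
1-3: by move=> k; have [] := fP k.
move=> x; have [h [K [sh h0 hx cK hK]]] := bump_exists x.
have : nbhs x [set y | 1 < h y].
  apply: open_nbhs_nbhs; split=> //.
  apply: (@open_comp _ _ h [set t | 1 < t]); last exact: open_gt.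
  by move=> y _; exact: smoothR_continuous.
move=> /(Bb x) /= [U [BU Ux] Uh].
have [k _ kU] : (s @` setT) U by rewrite -sE.
exists k; have [_ _ _ /(_ (h, K) sh cK hK)] := fP k.
by rewrite /= kU => /(_ Uh) /(_ x Ux).
Qed.

(** With [th j] equal to 0 where c_j >= 1 and to 1 off K_j, put p = sum_k prod_(j < k) [th j]. Near
    a point with c_j > 1 all terms beyond j vanish, so the sum is locally finite. Off K_0, ...,
    K_(N-1) the first N terms are 1, so p >= N there. *)
Lemma exhaustion_exists : exists p : M -> R,
  [/\ smoothR p, forall x, 0 <= p x & forall t, compact [set x | p x <= t]].
Proof.
have [c [K [sc cK cK0 cc]]] := bump_cover.
have f1 : 0 < flat 0 (1 : R) by rewrite flat_gt0.
pose th k x := (flat 0 1)^-1 * flat 0 (1 - c k x).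
pose u k x := \prod_(j < k) th j x.
have sth k : smoothR (th k).
  by apply/smoothRZ/smoothR_flat/smoothRB => //; exact: smoothR_cst.
have th0 k x : 0 <= th k x by rewrite mulr_ge0 ?flat_ge0 ?invr_ge0 ?flat_ge0.
have su k : smoothR (u k) by apply: smoothR_prod.
have u0 k x : 0 <= u k x by apply: prodr_ge0.
have ufin k x : 1 <= c k x -> forall l, (k.+1 <= l)%N -> u l x = 0.
  move=> ckx l kl; rewrite /u (bigD1 (Ordinal kl))//= /th (flat_eq0 (t := 1 - c k x)) ?mulr0 ?mul0r//.
  by rewrite subr_le0.
have lf (x : M) : exists N, \forall y \near x, forall k, (N <= k)%N -> u k y = 0.
  have [k ckx] := cc x; exists k.+1.
  have : nbhs x [set y | 1 < c k y].
    apply: open_nbhs_nbhs; split=> //.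
    apply: (@open_comp _ _ (c k) [set t | 1 < t]); last exact: open_gt.
    by move=> y _; exact: smoothR_continuous.
  by apply: filterS => y /= /ltW /ufin.
have [p sp pE] := smoothR_locally_finite su lf.
have pN x N : N%:R <= p x \/ exists2 j, (j < N)%N & K j x.
  have [E|nE] := pselect (exists2 j, (j < N)%N & K j x); [by right|left].
  have [k ckx] := cc x.
  have th1 j : (j < N)%N -> th j x = 1.
    move=> jN; rewrite /th cK0 ?subr0 ?mulVf ?gt_eqF//.
    by move=> Kj; apply: nE; exists j.
  have u1 j : (j < N)%N -> u j x = 1.
    by move=> jN; apply: big1 => i _; rewrite th1// (ltn_trans _ jN).
  rewrite (pE x (N + k.+1)%N); last first.
    by move=> l Nl; apply: (ufin k x (ltW ckx)); apply: leq_trans Nl; exact: leq_addl.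
  rewrite big_split_ord/= (eq_bigr (fun=> 1)) => [|i _]; last by rewrite u1.
  by rewrite sumr_const card_ord lerDl sumr_ge0.
exists p; split=> //.
  by move=> x; have [//|[]] := pN x 0.
move=> t; have [N tN] : exists N, t < N%:R.
  by exists (Num.truncn t).+1; rewrite truncnS_gt.
apply: (@subclosed_compact _ _ (\big[setU/set0]_(j < N) K j)).
- apply: (@closed_comp _ _ p [set s | s <= t]); last exact: closed_le.
  by move=> y _; exact: smoothR_continuous.
- apply: bigsetU_compact => i _; exact: cK.
move=> x /= pt; have [Np|[j jN Kj]] := pN x N.
  by have := le_lt_trans pt tN; rewrite ltNge Np.
by rewrite -bigcup_mkord; exists j.
Qed.

End RealSmooth.

(** * Positive functionals on real smooth functions *)

Lemma le0_of_small (R : realFieldType) (a b : R) :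
  (forall e, 0 < e -> a <= e * b) -> a <= 0.
Proof.
move=> H; rewrite leNgt; apply/negP => a0.
have b0 : 0 < `|b| + 1 by rewrite ltr_wpDl.
have := H (a / (2 * (`|b| + 1))); rewrite divr_gt0 ?mulr_gt0// => /(_ isT).
rewrite leNgt => /negP; apply.
rewrite mulrAC ltr_pdivrMr ?mulr_gt0// ltr_pM2l//.
have := ler_norm b; lra.
Qed.

Section RealPart.
Variables (R : realType) (n : nat) (M : smoothManifoldType R n).
Local Notation C := (R[i]).
Implicit Types (h g : M -> R) (f a : Cinfty M).

Lemma realC_subproof h : smoothR h -> `[< smooth_fun (fun x => (h x)%:C%C) >].
Proof.
by move=> sh; apply/asboolP => c ac; split; [exact: sh|exact: smooth_on_cst].
Qed.
Definition realC h (sh : smoothR h) : Cinfty M := MkCinfty (realC_subproof sh).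

Definition nsq f x : R := complex.Re (f x) ^+ 2 + complex.Im (f x) ^+ 2.

Lemma smoothR_Re f : smoothR (fun x => complex.Re (f x)).
Proof. by move=> c ac; have [] := Cinfty_smooth f ac. Qed.

Lemma smoothR_Im f : smoothR (fun x => complex.Im (f x)).
Proof. by move=> c ac; have [] := Cinfty_smooth f ac. Qed.

Lemma smoothR_sqr h : smoothR h -> smoothR (fun x => h x ^+ 2).
Proof.
by move=> sh; under [X in smoothR X]eq_fun do rewrite expr2; exact: smoothRM.
Qed.

Lemma smoothR_nsq f : smoothR (nsq f).
Proof. by apply: smoothRD; apply: smoothR_sqr; [exact: smoothR_Re|exact: smoothR_Im]. Qed.

Lemma nsq_ge0 f x : 0 <= nsq f x.
Proof. by rewrite addr_ge0 ?sqr_ge0. Qed.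

Lemma nsq_eq0 f x : (nsq f x == 0) = (f x == 0).
Proof. by rewrite /nsq paddr_eq0 ?sqr_ge0// !sqrf_eq0 eq_complex. Qed.

Lemma star_mulE f x : (star f ** f) x = (nsq f x)%:C%C.
Proof.
rewrite CinftyME Cinfty_starE /nsq mulrC -normCK; symmetry; exact: add_Re2_Im2.
Qed.

Lemma star_mul_realC f : star f ** f = realC (smoothR_nsq f).
Proof. by apply: Cinfty_eq => x; rewrite star_mulE. Qed.

Lemma nsqZ (t : R) f x : nsq (t%:C%C *: f) x = t ^+ 2 * nsq f x.
Proof.
rewrite /nsq CinftyZE; case: (f x) => u v /=; ring.
Qed.

Definition zeros (I : set (Cinfty M)) : set M := [set x | forall a, I a -> a x = 0].

Lemma zeros_closed (I : set (Cinfty M)) : closed (zeros I).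
Proof.
have -> : zeros I = \bigcap_(a in I) [set x | nsq a x = 0].
  apply/seteqP; split=> x /= Ix a Ia.
    by apply/eqP; rewrite nsq_eq0 Ix.
  by apply/eqP; rewrite -nsq_eq0 Ix.
apply: closed_bigI => a _.
apply: (@closed_comp _ _ (nsq a) [set t | t = 0]); last exact: closed_eq.
by move=> x _; apply: smoothR_continuous; exact: smoothR_nsq.
Qed.

Section Functional.
Variable w : posFunctional (Cinfty M).

(* Extended by 0 to functions that are not smooth, so as to avoid carrying    *)
(* smoothness proofs in its argument.                                         *)
Definition rpart h : R :=
  if pselect (smoothR h) is left sh then complex.Re (w (realC sh)) else 0.

Lemma rpartE h (sh : smoothR h) : rpart h = complex.Re (w (realC sh)).
Proof.
rewrite /rpart; case: pselect => // sh'; congr (complex.Re (w _)).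
exact: Cinfty_eq.
Qed.

Lemma rpartD g h : smoothR g -> smoothR h ->
  rpart (fun x => g x + h x) = rpart g + rpart h.
Proof.
move=> sg sh; rewrite (rpartE sg) (rpartE sh) (rpartE (smoothRD sg sh)).
have -> : realC (smoothRD sg sh) = realC sg + realC sh.
  by apply: Cinfty_eq => x; rewrite CinftyDE /= rmorphD.
by rewrite linearD /= raddfD.
Qed.

Lemma rpartZ (t : R) h : smoothR h -> rpart (fun x => t * h x) = t * rpart h.
Proof.
move=> sh; rewrite (rpartE sh) (rpartE (smoothRZ t sh)).
have -> : realC (smoothRZ t sh) = t%:C%C *: realC sh.
  by apply: Cinfty_eq => x; rewrite CinftyZE /= rmorphM.
by rewrite linearZ /=; case: (w _) => u v /=; rewrite mul0r subr0.
Qed.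

Lemma star_mul_rpart f : w (star f ** f) = (rpart (nsq f))%:C%C.
Proof.
rewrite (rpartE (smoothR_nsq f)) -star_mul_realC.
have := posf_ge0 w f; case: (w _) => u v; rewrite lecE /= => /andP[/eqP -> _] //.
Qed.

Lemma rpart_nsq_ge0 f : 0 <= rpart (nsq f).
Proof. by rewrite -lecR -star_mul_rpart; exact: posf_ge0. Qed.

Lemma rpart_gt0_ge0 h : smoothR h -> (forall x, 0 < h x) -> 0 <= rpart h.
Proof.
move=> sh h0; have := rpart_nsq_ge0 (realC (smoothR_sqrt h0 sh)).
have -> // : nsq (realC (smoothR_sqrt h0 sh)) = h.
by apply/funext => x; rewrite /nsq /= expr0n addr0 sqr_sqrtr// ltW.
Qed.

(** The square root of [h] need not be smooth at zeros of [h], so positivity is obtained for h + e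
    and e tends to 0. *)
Lemma rpart_ge0 h : smoothR h -> (forall x, 0 <= h x) -> 0 <= rpart h.
Proof.
move=> sh h0; rewrite -oppr_le0; apply: (@le0_of_small _ _ (rpart (fun=> 1))) => e e0.
have s1 := @smoothR_cst R n M 1.
rewrite lerNl -subr_ge0 opprK addrC.
rewrite -(rpartZ _ s1) -rpartD//; last exact: smoothRZ.
apply: rpart_gt0_ge0; first by apply: smoothRD => //; exact: smoothRZ.
by move=> x; rewrite mulr1 ltr_wpDr.
Qed.

Lemma rpart_le g h : smoothR g -> smoothR h -> (forall x, g x <= h x) ->
  rpart g <= rpart h.
Proof.
move=> sg sh gh; have sN := smoothRZ (-1) sg.
have : 0 <= rpart (fun x => h x + -1 * g x).
  by apply: rpart_ge0 => [|x]; [exact: smoothRD|rewrite mulN1r subr_ge0].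
by rewrite rpartD// rpartZ// mulN1r subr_ge0.
Qed.

Lemma rpart_sum (I : Type) (s : seq I) (h : I -> M -> R) :
  (forall i, smoothR (h i)) ->
  rpart (fun x => \sum_(i <- s) h i x) = \sum_(i <- s) rpart (h i).
Proof.
move=> sh; elim: s => [|i s IH].
  have -> : (fun x => \sum_(i <- [::]) h i x) = (fun x : M => 0 * 0).
    by apply/funext => x; rewrite big_nil mul0r.
  by rewrite rpartZ ?mul0r ?big_nil//; exact: smoothR_cst.
have -> : (fun x => \sum_(j <- i :: s) h j x) =
    (fun x => h i x + \sum_(j <- s) h j x).
  by apply/funext => x; rewrite big_cons.
rewrite rpartD ?big_cons ?IH//; exact: smoothR_sum.
Qed.

Lemma posf_zeros (I : set (Cinfty M)) f : I 0 ->
  (forall (k : C) a, I a -> I (k *: a)) ->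
  (forall a, I a -> w (star a ** a) = 0) ->
  vanishing_ideal (zeros I) f -> w (star f ** f) = 0.
Proof.
move=> I0 IZ Iw f0.
have wI a : I a -> rpart (nsq a) = 0.
  by move=> /Iw; rewrite star_mul_rpart => -[].
have [p [sp p0 pc]] := @exhaustion_exists R n M.
rewrite star_mul_rpart; congr (_%:C%C); apply/eqP.
have sf := smoothR_nsq f.
have spf := smoothRM sp sf.
have s1 := @smoothR_cst R n M 1.
rewrite eq_le rpart_nsq_ge0 andbT.
(* The aim is the pointwise bound |f|^2 <= e + e p |f|^2 + j0 with j0 >= 0 and w(j0) = 0. *)
apply: (@le0_of_small _ _ (rpart (fun=> 1) + rpart (fun x => p x * nsq f x))) => e e0.
pose V a := [set x | nsq f x - nsq a x < e].
have Vo a : open (V a).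
  apply: (@open_comp _ _ (fun x => nsq f x - nsq a x) [set t | t < e]); last exact: open_lt.
  by move=> x _; apply: smoothR_continuous; apply: smoothRB => //; exact: smoothR_nsq.
pose J := [set j : M -> R | [/\ smoothR j, forall x, 0 <= j x & rpart j = 0]].
have Jnsq a : I a -> J (nsq a).
  by move=> Ia; split; [exact: smoothR_nsq|exact: nsq_ge0|exact: wI].
(* [J] is directed, so one of its elements serves a whole compact set. *)
pose F : set_system (M -> R) :=
  [set S | exists2 j, J j & forall j', (forall x, j x <= j' x) -> S j'].
have FF : Filter F.
  split.
  - by exists (nsq 0) => //; exact: Jnsq.
  - move=> S T [j [sj j0 Lj] jS] [k [sk k0 Lk] kT].
    exists (fun x => j x + k x) => [|j' jk].
      split; [exact: smoothRD|by move=> x; exact: addr_ge0|].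
      by rewrite rpartD// Lj Lk addr0.
    by split; [apply: jS|apply: kT] => x; apply: le_trans (jk x);
      rewrite ?lerDl ?lerDr.
  - by move=> S T ST [j Jj jS]; exists j => // j' /jS /ST.
have cov := (compact_near_coveringP _).1 (pc e^-1) _ F
  (fun j x => nsq f x - j x < e) FF.
have {cov} [|j0 [sj j0ge Lj0] /(_ j0 (fun=> lexx _)) jV] := cov.
  move=> x _.
  have [a Ia Vax] : exists2 a, I a & V a x.
    have [fx|fx] := eqVneq (f x) 0.
      exists 0 => //=; rewrite /V /=; have /eqP -> : nsq f x == 0 by rewrite nsq_eq0 fx.
      by rewrite ltrBlDr ltr_wpDr ?nsq_ge0.
    have [a Ia ax] : exists2 a, I a & a x != 0.
      apply: contrapT => nE; move/eqP: fx; apply; apply: f0 => a Ia.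
      by apply/eqP/negP => /negP ax; apply: nE; exists a.
    have a0 : 0 < nsq a x by rewrite lt0r nsq_ge0 nsq_eq0 ax.
    (* This factor makes |t a|^2 equal to |f|^2 at [x]. *)
    pose t := Num.sqrt (nsq f x / nsq a x).
    exists (t%:C%C *: a); first exact: IZ.
    rewrite /V /= nsqZ sqr_sqrtr ?divr_ge0 ?nsq_ge0// divfK ?gt_eqF//.
    by rewrite subrr.
  exists (V a, [set j | forall x, nsq a x <= j x]).
    split; first exact: open_nbhs_nbhs (conj (Vo a) Vax).
    by exists (nsq a) => //; exact: Jnsq.
  move=> [y j] [/= Vay aj]; apply: le_lt_trans Vay.
  by rewrite lerD2l lerN2.
have -> : e * (rpart (fun=> 1) + rpart (fun x => p x * nsq f x)) =
    rpart (fun x => e * 1 + (e * (p x * nsq f x) + j0 x)).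
  rewrite rpartD ?rpartZ ?rpartD ?rpartZ ?Lj0 ?addr0 ?mulrDr//.
  - exact: smoothRZ.
  - exact: smoothRZ.
  - by apply: smoothRD => //; exact: smoothRZ.
apply: rpart_le => //.
  by apply: smoothRD; [exact: smoothRZ|apply: smoothRD => //; exact: smoothRZ].
move=> x; have fx := nsq_ge0 f x.
(* On the compact sublevel set [j0] does the work; outside it e p > 1, and the term e p |f|^2
   already dominates. *)
have [px|px] := leP (p x) e^-1.
  have := jV x px; have : 0 <= e * (p x * nsq f x) by rewrite !mulr_ge0 ?(ltW e0).
  by lra.
have : 1 <= e * p x by rewrite -ler_pdivrMl// mulr1 ltW.
move=> /(ler_wpM2r fx); rewrite mul1r -mulrA; have := j0ge x; lra.
Qed.

Lemma zeros_bounded (p : M -> R) (I : set (Cinfty M)) : smoothR p ->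
  (forall a, w (star a ** a) = 0 -> vanishing_ideal (zeros I) a) ->
  exists N : nat, forall x, zeros I x -> p x <= N%:R.
Proof.
move=> sp Iw; apply: contrapT => /forallNP H.
have {}H (N : nat) : exists2 x, zeros I x & N%:R < p x.
  have /existsNP[x /not_implyP[Ix /negP]] := H N.
  by rewrite -ltNge; exists x.
(* [u k] is nonzero at some common zero, so w cannot kill its square; it vanishes on {p <= k}, so
   the family is locally finite. *)
pose u (k : nat) x := flat 0 (p x - k%:R).
have su k : smoothR (u k) by apply/smoothR_flat/smoothRB => //; exact: smoothR_cst.
have Lu k : 0 < rpart (fun x => u k x ^+ 2).
  have uE : nsq (realC (su k)) = (fun x => u k x ^+ 2).
    by apply/funext => x; rewrite /nsq /= expr0n addr0.
  rewrite -uE lt0r rpart_nsq_ge0 andbT; apply/eqP => L0.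
  have /Iw van : w (star (realC (su k)) ** realC (su k)) = 0.
    by rewrite star_mul_rpart L0.
  have [x Ix kx] := H k; have /= [/eqP] := van x Ix.
  by apply/negP; rewrite gt_eqF// flat_gt0 subr_gt0.
pose v k x := (rpart (fun x => u k x ^+ 2))^-1 * u k x ^+ 2.
have sv k : smoothR (v k) by apply/smoothRZ/smoothR_sqr.
have Lv k : rpart (v k) = 1.
  by rewrite rpartZ ?mulVf ?gt_eqF//; exact: smoothR_sqr.
have v0 k x : 0 <= v k x by rewrite mulr_ge0 ?sqr_ge0 ?invr_ge0 ?(ltW (Lu k)).
have vfin x N : p x <= N%:R -> forall k, (N <= k)%N -> v k x = 0.
  move=> pN k Nk; rewrite /v /u flat_eq0 ?expr0n ?mulr0// subr_le0.
  by apply: le_trans pN _; rewrite ler_nat.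
have pb (x : M) : exists N, p x < N%:R.
  by exists (Num.truncn (p x)).+1; rewrite truncnS_gt.
have lf (x : M) : exists N, \forall y \near x, forall k, (N <= k)%N -> v k y = 0.
  have [N pN] := pb x; exists N.
  have : nbhs x [set y | p y < N%:R].
    apply: open_nbhs_nbhs; split=> //.
    apply: (@open_comp _ _ p [set t | t < N%:R]); last exact: open_lt.
    by move=> y _; exact: smoothR_continuous.
  by apply: filterS => y /= /ltW; exact: vfin.
have [g sg gE] := smoothR_locally_finite sv lf.
(* By monotonicity w(g) dominates w of every partial sum, which is N by the normalisation of [v]. *)
have gN N : N%:R <= rpart g.
  have <- : rpart (fun x => \sum_(k < N) v k x) = N%:R.
    by rewrite rpart_sum// (eq_bigr (fun=> 1))// sumr_const card_ord.
  apply: rpart_le => //; first exact: smoothR_sum.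
  move=> x; have [N' pN'] := pb x.
  rewrite (gE x (N + N')%N); last first.
    by move=> k kN; apply: (vfin x N' (ltW pN')); apply: leq_trans kN; exact: leq_addl.
  by rewrite big_split_ord/= lerDl sumr_ge0.
have := gN (Num.truncn (rpart g)).+1.
by rewrite leNgt truncnS_gt.
Qed.

End Functional.
End RealPart.

(** * Finitely supported functions and multiplication operators *)

(** On this dense subspace of l^2(T) multiplication by any function, bounded or not, is everywhere
    defined and adjointable. *)
Record finsuppFun (C : numClosedFieldType) (T : choiceType) := FinsuppFun {
  finsuppFun_fun :> T -> C;
  finsuppFunP : `[< finite_set [set x | finsuppFun_fun x != 0] >]
}.

Section FinsuppFun.
Variables (C : numClosedFieldType) (T : choiceType).
Local Notation H := (finsuppFun C T).
Implicit Types u v : H.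

HB.instance Definition _ := [isSub for (@finsuppFun_fun C T)].
HB.instance Definition _ := [Choice of H by <:].

Lemma fs_eq u v : (forall x, u x = v x) -> u = v.
Proof. by move=> uv; apply: val_inj; apply/funext. Qed.

Lemma fs_finite u : finite_set [set x | u x != 0].
Proof. by case: u => u /= /asboolP. Qed.

Lemma fs_zero_subproof : `[< finite_set [set x : T | (0 : C) != 0] >].
Proof.
by apply/asboolP; apply: (sub_finite_set _ (finite_set0 T)) => x /=; rewrite eqxx.
Qed.
Definition fs_zero : H := FinsuppFun fs_zero_subproof.

Lemma fs_add_subproof u v : `[< finite_set [set x | u x + v x != 0] >].
Proof.
apply/asboolP; apply: (@sub_finite_set _ _ ([set x | u x != 0] `|` [set x | v x != 0])).
  move=> x /=; have [->|] := eqVneq (u x) 0; last by left.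
  by rewrite add0r; right.
by rewrite finite_setU; split; exact: fs_finite.
Qed.
Definition fs_add u v := FinsuppFun (fs_add_subproof u v).

Lemma fs_diag_subproof (d : T -> C) u : `[< finite_set [set x | d x * u x != 0] >].
Proof.
apply/asboolP; apply: (sub_finite_set _ (fs_finite u)) => x /=.
by apply: contraNneq => ->; rewrite mulr0.
Qed.
Definition fs_diag (d : T -> C) u := FinsuppFun (fs_diag_subproof d u).

Fact fs_addA : associative fs_add.
Proof. by move=> u v t; apply: fs_eq => x /=; rewrite addrA. Qed.
Fact fs_addC : commutative fs_add.
Proof. by move=> u v; apply: fs_eq => x /=; rewrite addrC. Qed.
Fact fs_add0 : left_id fs_zero fs_add.
Proof. by move=> u; apply: fs_eq => x /=; rewrite add0r. Qed.
Fact fs_addN : left_inverse fs_zero (fs_diag (fun=> -1)) fs_add.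
Proof. by move=> u; apply: fs_eq => x /=; rewrite mulN1r addNr. Qed.
HB.instance Definition _ := GRing.isZmodule.Build H fs_addA fs_addC fs_add0 fs_addN.

Definition fs_scale (k : C) u := fs_diag (fun=> k) u.
Fact fs_scaleA (k l : C) u : fs_scale k (fs_scale l u) = fs_scale (k * l) u.
Proof. by apply: fs_eq => x /=; rewrite mulrA. Qed.
Fact fs_scale1 : left_id 1 fs_scale.
Proof. by move=> u; apply: fs_eq => x /=; rewrite mul1r. Qed.
Fact fs_scaleDr : right_distributive fs_scale +%R.
Proof. by move=> k u v; apply: fs_eq => x /=; rewrite mulrDr. Qed.
Fact fs_scaleDl u : {morph fs_scale^~ u : k l / k + l}.
Proof. by move=> k l; apply: fs_eq => x /=; rewrite mulrDl. Qed.
HB.instance Definition _ := GRing.Zmodule_isLmodule.Build C H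
  fs_scaleA fs_scale1 fs_scaleDr fs_scaleDl.

Lemma fs_addE u v x : (u + v) x = u x + v x. Proof. by []. Qed.
Lemma fs_scaleE k u x : (k *: u) x = k * u x. Proof. by []. Qed.

Definition fs_inner u v : C := \sum_(x \in [set: T]) (u x)^* * v x.

Lemma fs_innerEl u v : fs_inner u v =
  \sum_(x <- fset_set [set x | u x != 0]) (u x)^* * v x.
Proof.
apply: fsbigTE => x; rewrite in_fset_set; last exact: fs_finite.
by rewrite notin_setE /= => /negP; rewrite negbK => /eqP ->; rewrite rmorph0 mul0r.
Qed.

Lemma fs_innerEr u v : fs_inner u v =
  \sum_(x <- fset_set [set x | v x != 0]) (u x)^* * v x.
Proof.
apply: fsbigTE => x; rewrite in_fset_set; last exact: fs_finite.
by rewrite notin_setE /= => /negP; rewrite negbK => /eqP ->; rewrite mulr0.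
Qed.

Fact fs_innerDr u v t : fs_inner u (v + t) = fs_inner u v + fs_inner u t.
Proof.
rewrite !fs_innerEl -big_split; apply: eq_bigr => x _.
by rewrite fs_addE mulrDr.
Qed.

Fact fs_innerZr k u v : fs_inner u (k *: v) = k * fs_inner u v.
Proof.
rewrite !fs_innerEl mulr_sumr; apply: eq_bigr => x _.
by rewrite fs_scaleE mulrCA.
Qed.

Fact fs_inner_conj u v : fs_inner v u = (fs_inner u v)^*.
Proof.
rewrite fs_innerEr fs_innerEl rmorph_sum; apply: eq_bigr => x _.
by rewrite rmorphM /= conjCK mulrC.
Qed.

Fact fs_inner_gt0 u : u != 0 -> 0 < fs_inner u u.
Proof.
move=> u0; have [x ux] : exists x, u x != 0.
  apply: contrapT => /forallNP nE; move/eqP: u0; apply.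
  by apply: fs_eq => x; have /negP := nE x; rewrite negbK => /eqP.
rewrite fs_innerEl (big_rem x)/=; last first.
  by rewrite in_fset_set ?mem_setE//; exact: fs_finite.
apply: ltr_pwDl; first by rewrite mulrC -normCK exprn_gt0// normr_gt0.
by apply: sumr_ge0 => y _; rewrite mulrC -normCK exprn_ge0.
Qed.

HB.instance Definition _ := isPreHilbert.Build C H
  fs_innerDr fs_innerZr fs_inner_conj fs_inner_gt0.

Lemma fs_diag_adjoint (d : T -> C) :
  is_adjoint (fs_diag (fun x => (d x)^*) : H -> H) (fs_diag d).
Proof.
move=> u v; rewrite [LHS]fs_innerEr [RHS](fs_innerEl u).
transitivity (fs_inner u (fs_diag d v)); last exact: fs_innerEl.
rewrite /fs_inner -[LHS]fs_innerEr /fs_inner; apply: eq_fsbigr => x _ /=.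
by rewrite rmorphM /= conjCK mulrA [_^* * d x]mulrC.
Qed.

Lemma fs_op_subproof (d : T -> C) : `[< adjointable (fs_diag d : H -> H) >].
Proof.
apply/asboolP; split; last by eexists; exact: fs_diag_adjoint.
by move=> k u v; apply: fs_eq => x /=; rewrite mulrDr mulrCA.
Qed.
Definition fs_op (d : T -> C) : adjOp H := AdjOp (fs_op_subproof d).

Lemma fs_op_star d : fs_op (fun x => (d x)^*) = star (fs_op d).
Proof. by apply/esym/adj_unique; exact: fs_diag_adjoint. Qed.

Lemma fs_op_eq0 d : fs_op d = 0 -> forall x, d x = 0.
Proof.
move=> d0 x.
have fin : `[< finite_set [set y : T | (if y == x then 1 else 0 : C) != 0] >].
  apply/asboolP; apply: (sub_finite_set _ (finite_set1 x)) => y /=.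
  by case: ifPn => [/eqP->//|_]; rewrite eqxx.
have : (fs_op d (FinsuppFun fin) : H) x = 0 by rewrite d0.
by rewrite /= eqxx mulr1.
Qed.
End FinsuppFun.

Section PointRep.
Variables (R : realType) (n : nat) (M : smoothManifoldType R n) (F : set M).
Local Notation C := (R[i]).
Implicit Types f g : Cinfty M.

(** Cutting [f] off outside [F] lets all of M index the space, while the kernel sees only the points
    of [F]. *)
Definition point_op f : adjOp (finsuppFun C M) :=
  fs_op (fun x => if x \in F then f x else 0).

Fact point_opD f g : point_op (f + g) = point_op f + point_op g.
Proof.
apply: adjOp_eq => u; apply: fs_eq => x; rewrite adjOp_addE fs_addE /=.
by case: ifP => _; rewrite ?CinftyDE ?mulrDl ?mul0r ?addr0.
Qed.
Fact point_opZ (k : C) f : point_op (k *: f) = k *: point_op f.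
Proof.
apply: adjOp_eq => u; apply: fs_eq => x; rewrite adjOp_scaleE fs_scaleE /=.
by case: ifP => _; rewrite ?CinftyZE ?mulrA ?mulr0 ?mul0r.
Qed.
Fact point_opM f g : point_op (f ** g) = point_op f ** point_op g.
Proof.
apply: adjOp_eq => u; apply: fs_eq => x; rewrite adjOp_mulE /=.
by case: ifP => _; rewrite ?CinftyME ?mulrA// !mul0r.
Qed.
Fact point_op_star f : point_op (star f) = star (point_op f).
Proof.
rewrite -fs_op_star; congr fs_op; apply/funext => x.
by case: ifP => _; rewrite ?Cinfty_starE// rmorph0.
Qed.

Definition point_rep : starRep (Cinfty M) (finsuppFun C M) :=
  StarHom point_opD point_opZ point_opM point_op_star.

Lemma point_rep_ker : starHom_ker point_rep = vanishing_ideal F.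
Proof.
apply/seteqP; split=> f.
  by move=> /fs_op_eq0 f0 x Fx; have := f0 x; rewrite mem_set.
move=> f0; apply: adjOp_eq => u; apply: fs_eq => x /=.
by case: ifPn => [/set_mem/f0 ->|_]; rewrite mul0r.
Qed.
End PointRep.

(** * Vector functionals of a representation *)

Section VectorState.
Variables (C : numClosedFieldType) (A : starAlgType C) (H : preHilbertType C).
Variables (pi : starRep A H) (v : H).

Definition vector_fun (a : A) : C := inner v (pi a v).

Fact vector_fun_scalar : scalar vector_fun.
Proof.
by move=> k a b; rewrite /vector_fun starHomD starHomZ /= innerDr innerZr.
Qed.
HB.instance Definition _ := GRing.isLinear.Build C A C *%R vector_fun vector_fun_scalar.

Lemma vector_fun_sqr a : vector_fun (star a ** a) = inner (pi a v) (pi a v).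
Proof.
rewrite /vector_fun starHomM starHom_star adjOp_mulE.
by rewrite -(adjOp_starP (star (pi a))) starK.
Qed.

Lemma vector_fun_ge0 a : 0 <= vector_fun (star a ** a).
Proof.
rewrite vector_fun_sqr; have [->|/inner_gt0/ltW//] := eqVneq (pi a v) 0.
by rewrite inner0r.
Qed.

Definition vector_functional : posFunctional A := PosFunctional vector_fun_ge0.

Lemma vector_functional_eq0 a :
  vector_functional (star a ** a) = 0 <-> pi a v = 0.
Proof.
rewrite [vector_functional _]vector_fun_sqr; split=> [|->]; last exact: inner0r.
by have [//|/inner_gt0 + av0] := eqVneq (pi a v) 0; rewrite av0 ltxx.
Qed.
End VectorState.

(** * Kernels of representations and of GNS representations *)

Section Ideals.
Variables (R : realType) (n : nat) (M : smoothManifoldType R n).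
Local Notation C := (R[i]).
Implicit Types (f a : Cinfty M) (w : posFunctional (Cinfty M)).

Lemma CinftyC (f g : Cinfty M) : f ** g = g ** f.
Proof. by apply: Cinfty_eq => x; rewrite !CinftyME mulrC. Qed.

(** Applying the operator of a to the class of 1 gives the class of a; conversely the null space is
    a left ideal, hence two-sided by commutativity. *)
Lemma gns_ker w : starHom_ker (gns_rep w) = [set a | w (star a ** a) = 0].
Proof.
have cls0 b : b \in gns_null w <-> gns_class w b = 0.
  have -> : 0 = gns_class w 0 by rewrite -(raddf0 (\pi_({ideal_quot (gns_null w)})%qT)).
  by rewrite gns_class_eq subr0.
apply/seteqP; split=> a /= a0.
  have : gns_rep w a (gns_class w (Cinfty_cst M 1)) = 0 by rewrite a0.
  rewrite [LHS]gns_op_class; have -> : a ** Cinfty_cst M 1 = a.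
    by apply: Cinfty_eq => x; rewrite CinftyME mulr1.
  by move=> /cls0; rewrite inE => /eqP.
apply: adjOp_eq => u; rewrite -[u]gns_class_repr [LHS]gns_op_class.
by apply/cls0; rewrite CinftyC; apply: gns_nullM; rewrite inE a0.
Qed.

Lemma sub_zeros (I : set (Cinfty M)) : I `<=` vanishing_ideal (zeros I).
Proof. by move=> a Ia x; apply. Qed.

Lemma ker_rep_vanishing (H : preHilbertType C) (pi : starRep (Cinfty M) H) :
  starHom_ker pi = vanishing_ideal (zeros (starHom_ker pi)).
Proof.
apply/seteqP; split=> [|f f0]; first exact: sub_zeros.
apply: adjOp_eq => v; apply/(vector_functional_eq0 pi v f).
apply: (posf_zeros _ _ _ f0).
- by have := starHomZ pi 0 0; rewrite !scale0r.
- by move=> k a a0; rewrite /starHom_ker /= (starHomZ pi) a0 scaler0.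
- by move=> a a0; apply/(vector_functional_eq0 pi v a); rewrite a0.
Qed.

(** One point of [K] is picked in each basic open set that meets [K]; [None] stands for those that
    miss it, which also covers empty [K]. *)
Lemma compact_dense_seq (K : set M) : exists X : nat -> option M,
  (forall k x, X k = Some x -> K x) /\
  (forall V y, open V -> K y -> V y -> exists k x, X k = Some x /\ V x).
Proof.
have [B /pfcard_geP Bc [Bo Bb]] := @manifold_second_countable R n M.
have [E|/surjfunPex[s /= sE]] := Bc.
  exists (fun=> None); split=> // V y _ _ _.
  by have [U [/=]] := Bb y setT filterT; rewrite E.
have H k : exists o : option M, (forall x, o = Some x -> K x /\ s k x) /\
    (forall y, K y -> s k y -> o <> None).
  have [[y [Ky sy]]|nE] := pselect (exists y, K y /\ s k y).
    by exists (Some y); split=> // x [<-].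
  by exists None; split=> // y Ky sy; exfalso; apply: nE; exists y.
have {H} /choice[X XP] := H.
exists X; split=> [k x /(XP k).1[]//|V y oV Ky Vy].
have /(Bb y) /= [U [BU Uy] UV] : nbhs y V by exact: open_nbhs_nbhs.
have [k _ kU] : (s @` setT) U by rewrite -sE.
have := (XP k).2 y Ky; rewrite kU => /(_ Uy).
case E : (X k) => [x|//] _; exists k, x; split=> //.
by apply: UV; rewrite -kU; have [] := (XP k).1 x E.
Qed.

(** * The functional sum_k 2^-k f(x_k) *)

Section SeqFunctional.
Variables (K : set M) (X : nat -> option M).
Hypothesis (cK : compact K) (XK : forall k x, X k = Some x -> K x).
Implicit Types h : M -> R.

Definition wterm h (k : nat) : R := 2^-1 ^+ k * oapp h 0 (X k).
Definition wsum h : R := limn (series (wterm h)).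

(** Compactness of [K] bounds [h] on it, so a geometric series dominates. *)
Lemma wsum_cvg h : smoothR h -> cvgn (series (wterm h)).
Proof.
move=> sh; have : compact (h @` K).
  by apply: continuous_compact cK; apply: continuous_subspaceT; exact: smoothR_continuous.
move=> /compact_bounded[B [_ /(_ (B + 1)) hB]].
have {}hB x : K x -> `|h x| <= B + 1.
  by move=> Kx; apply: hB; [rewrite ltrDl|exists x].
apply: normed_cvg; apply: (@series_le_cvg _ _ (fun k => `|B + 1| * 2^-1 ^+ k)).
- by move=> k /=.
- by move=> k; rewrite mulr_ge0// exprn_ge0// invr_ge0.
- move=> k; rewrite /= /wterm normrM mulrC [X in _ * X]ger0_norm ?exprn_ge0 ?invr_ge0//.
  rewrite ler_wpM2r ?exprn_ge0 ?invr_ge0//.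
  case E : (X k) => [x|] /=; last by rewrite normr0.
  by apply: le_trans (ler_norm _); apply: hB; exact: XK E.
- by apply: is_cvg_geometric_series; rewrite ger0_norm ?invr_ge0// invf_lt1// ltr1n.
Qed.

Lemma wsumD g h : smoothR g -> smoothR h ->
  wsum (fun x => g x + h x) = wsum g + wsum h.
Proof.
move=> sg sh; rewrite /wsum -limD; [|exact: wsum_cvg..].
congr (limn _); rewrite -seriesD; congr series; apply/funext => k.
by rewrite /wterm fctE -mulrDr; congr (_ * _); case: (X k) => //=; rewrite addr0.
Qed.

Lemma wsumZ (t : R) h : smoothR h -> wsum (fun x => t * h x) = t * wsum h.
Proof.
move=> sh; transitivity (limn (t *: series (wterm h))).
  congr (limn _); rewrite -seriesZ; congr series; apply/funext => k.
  by rewrite /wterm fctE scalerAr; congr (_ * _); case: (X k) => //=; rewrite scaler0.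
exact: limZl_tmp (wsum_cvg sh).
Qed.

(** This makes the functional faithful on the sequence: if the sum for |f|^2 is 0, each term is. *)
Lemma wsum_term_le h k : smoothR h -> (forall x, 0 <= h x) -> wterm h k <= wsum h.
Proof.
move=> sh h0.
have t0 l : 0 <= wterm h l.
  by rewrite mulr_ge0 ?exprn_ge0 ?invr_ge0//; case: (X l).
apply: (@le_trans _ _ (series (wterm h) k.+1)).
  by rewrite seriesSr lerDr sumr_ge0.
apply: nondecreasing_cvgn_le; last exact: wsum_cvg.
by apply: nondecreasing_series => l _ _; exact: t0.
Qed.

Definition seq_fun f : C :=
  (wsum (fun x => complex.Re (f x)) +i* wsum (fun x => complex.Im (f x)))%C.

Fact seq_fun_scalar : scalar seq_fun.
Proof.
move=> k a b; case: k => u v; rewrite /seq_fun.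
have sRa := smoothR_Re a; have sIa := smoothR_Im a.
have sRb := smoothR_Re b; have sIb := smoothR_Im b.
have -> : (fun x => complex.Re ((((u +i* v)%C : C) *: a + b) x)) =
   (fun x => u * complex.Re (a x) + (- v * complex.Im (a x) + complex.Re (b x))).
  apply/funext => x; rewrite CinftyDE CinftyZE.
  by case: (a x) => ? ?; case: (b x) => ? ? /=; ring.
have -> : (fun x => complex.Im ((((u +i* v)%C : C) *: a + b) x)) =
   (fun x => u * complex.Im (a x) + (v * complex.Re (a x) + complex.Im (b x))).
  apply/funext => x; rewrite CinftyDE CinftyZE.
  by case: (a x) => ? ?; case: (b x) => ? ? /=; ring.
rewrite !wsumD ?wsumZ//; try exact: smoothRZ; try (apply: smoothRD => //; exact: smoothRZ).
by apply/eqP; rewrite eq_complex /=; apply/andP; split; apply/eqP; ring.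
Qed.
HB.instance Definition _ := GRing.isLinear.Build C (Cinfty M) C *%R seq_fun seq_fun_scalar.

Lemma wsum0 : wsum (fun=> 0) = 0.
Proof.
rewrite -[RHS](mul0r (wsum (fun=> 0))) -wsumZ; last exact: smoothR_cst.
by congr wsum; apply/funext => x; rewrite mul0r.
Qed.

Lemma seq_fun_sqr f : seq_fun (star f ** f) = (wsum (nsq f))%:C%C.
Proof.
rewrite /seq_fun; congr (Complex _ _).
  by congr wsum; apply/funext => x; rewrite star_mulE.
by rewrite -[RHS]wsum0; congr wsum; apply/funext => x; rewrite star_mulE.
Qed.

Lemma wsum_nsq_ge0 f : 0 <= wsum (nsq f).
Proof.
apply: le_trans (wsum_term_le 0 (smoothR_nsq f) (nsq_ge0 f)).
by rewrite mulr_ge0 ?exprn_ge0//; case: (X 0) => //= x; exact: nsq_ge0.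
Qed.

Lemma seq_fun_ge0 f : 0 <= seq_fun (star f ** f).
Proof. by rewrite seq_fun_sqr lecR; exact: wsum_nsq_ge0. Qed.

Definition seq_functional : posFunctional (Cinfty M) := PosFunctional seq_fun_ge0.

Lemma seq_functional_eq0 f : seq_functional (star f ** f) = 0 <->
  (forall k x, X k = Some x -> f x = 0).
Proof.
rewrite [seq_functional _]seq_fun_sqr; split=> [[f0] k x kx|f0].
  have := wsum_term_le k (smoothR_nsq f) (nsq_ge0 f).
  rewrite f0 /wterm kx /= pmulr_rle0 ?exprn_gt0 ?invr_gt0//.
  by move=> le0; apply/eqP; rewrite -nsq_eq0 eq_le le0 nsq_ge0.
congr (_%:C)%C; rewrite -[RHS]wsum0 /wsum; congr (limn (series _)).
apply/funext => k; rewrite /wterm; case E : (X k) => [x|//] /=; congr (_ * _).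
by apply/eqP; rewrite nsq_eq0; apply/eqP; exact: f0 E.
Qed.
End SeqFunctional.

Lemma compact_gns (K : set M) : compact K ->
  exists w, starHom_ker (gns_rep w) = vanishing_ideal K.
Proof.
move=> cK; have [X [XK Xd]] := compact_dense_seq K.
exists (seq_functional cK XK); rewrite gns_ker; apply/seteqP; split=> f /=.
  move=> /(seq_functional_eq0 cK XK f) f0 y Ky; apply/eqP; rewrite -nsq_eq0.
  apply/negP => /negP fy.
  have oV : open [set x | nsq f x != 0].
    apply: (@open_comp _ _ (nsq f) [set t | t != 0]); last exact: open_neq.
    by move=> x _; apply: smoothR_continuous; exact: smoothR_nsq.
  have [k [x [kx /=]]] := Xd _ y oV Ky fy.
  by rewrite nsq_eq0 (f0 k x kx) eqxx.
by move=> f0; apply/(seq_functional_eq0 cK XK f) => k x kx; apply: f0; exact: XK kx.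
Qed.

Lemma gns_zeros_compact w : compact (zeros (starHom_ker (gns_rep w))).
Proof.
have [p [sp _ pc]] := @exhaustion_exists R n M.
have [|N Np] := zeros_bounded (w := w) (I := starHom_ker (gns_rep w)) sp.
  by move=> a a0; rewrite -ker_rep_vanishing gns_ker.
exact: subclosed_compact (@zeros_closed _ _ _ _) (pc N%:R) Np.
Qed.
End Ideals.

Theorem proposition6p1 (R : realType) (n : nat) (M : smoothManifoldType R n)
    (I : set (Cinfty M)) (hI : star_ideal I) :
  (closed_ideal I <->
     exists F : set M, closed F /\ I = vanishing_ideal F) /\
  ((exists w : posFunctional (Cinfty M), I = starHom_ker (gns_rep w)) <->
     exists K : set M, compact K /\ I = vanishing_ideal K).
Proof.
split; split.
- move=> [H [pi ->]]; exists (zeros (starHom_ker pi)).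
  by split; [exact: zeros_closed|exact: ker_rep_vanishing].
- move=> [F [_ ->]]; exists (finsuppFun R[i] M), (point_rep F).
  by rewrite point_rep_ker.
- move=> [w ->]; exists (zeros (starHom_ker (gns_rep w))).
  by split; [exact: gns_zeros_compact|exact: ker_rep_vanishing].
- by move=> [K [/compact_gns[w wK] ->]]; exists w.
Qed.
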